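(* For any $p\in(1,\infty)$, any $f\in L^p(\mathbb{R}^N)$, any $\gamma\in(0,1)$ and any $t>0$, the function $T_p(t)f$ belongs to $C_b^{1+\gamma}(\mathbb{R}^N)$. In particular, the semigroup $(T_p(t))_{t\ge0}$ is ultracontractive, i.e. $T_p(t)$ maps $L^p(\mathbb{R}^N)$ into $L^\infty(\mathbb{R}^N)$ for every $t>0$.
   Context: Let $N$ be a positive integer, $\alpha\in[0,2]$ and $\beta\ge 0$ with $\alpha^2+\beta^2\neq 0$. Set $a(x)=1+|x|^\alpha$, $V(x)=|x|^\beta$, $\mathcal{A}u=a\Delta u-Vu$ on $\mathbb{R}^N$. For $p\in(1,\infty)$, $A_p$ is the realization of $\mathcal{A}$ in $L^p(\mathbb{R}^N)$ with domain $D(A_p)=\{u\in W^{2,p}(\mathbb{R}^N): a|D^2u|,\ a^{1/2}|\nabla u|,\ Vu\in L^p(\mathbb{R}^N)\}$. The operator $A_p$ generates a strongly continuous analytic semigroup $(T_p(t))_{t\ge0}$ in $L^p(\mathbb{R}^N)$; these semigroups are positive and consistent in $p$. $C_b^{1+\gamma}(\mathbb{R}^N)$ is the space of bounded $C^1$ functions whose first order derivatives are bounded and (globally) $\gamma$-Hölder continuous. *)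

(* Defs.v *)
From HB Require Import structures.
From mathcomp Require Import all_boot all_order all_algebra.
From mathcomp Require Import all_classical all_reals all_analysis.
From mathcomp.real_closed Require Import complex.

Set Implicit Arguments.
Unset Strict Implicit.
Unset Printing Implicit Defensive.
Import Order.TTheory GRing.Theory Num.Theory.
Import numFieldNormedType.Exports.
Local Open Scope classical_set_scope.
Local Open Scope ring_scope.

Section rV_measurable.
Context {R : realType} (n : nat).

(* The product sigma-algebra, which is also the Borel sigma-algebra of R^n. *)
Let coord (i : 'I_n) (x : 'rV[R]_n) : R := x ord0 i.

Let rV_set0 : g_sigma_preimage coord set0.
Proof. exact: sigma_algebra0. Qed.

Let rV_setC A : g_sigma_preimage coord A -> g_sigma_preimage coord (~` A).
Proof. exact: sigma_algebraC. Qed.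

Let rV_bigcup (F : _^nat) : (forall i, g_sigma_preimage coord (F i)) ->
  g_sigma_preimage coord (\bigcup_i (F i)).
Proof. exact: sigma_algebra_bigcup. Qed.

HB.instance Definition _ := @isMeasurable.Build
  (measure_tuple_display default_measure_display)
  'rV[R]_n (g_sigma_preimage coord) rV_set0 rV_setC rV_bigcup.

Lemma measurable_coord (i : 'I_n) : measurable_fun [set: 'rV[R]_n] (coord i).
Proof.
move=> _ Y mY; rewrite setTI; apply: sub_sigma_algebra => /=.
rewrite -bigcup_seq/=; exists i => /=; first by rewrite mem_index_enum.
by exists Y => //; rewrite setTI.
Qed.

Lemma measurable_fun_rV d (T : measurableType d) (f : T -> 'rV[R]_n) :
  (forall i, measurable_fun [set: T] (coord i \o f)) ->
  measurable_fun [set: T] f.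
Proof.
move=> mf _ A mA; rewrite setTI.
have : preimage_set_system setT f (g_sigma_preimage coord) (f @^-1` A).
  by exists A => //; rewrite setTI.
rewrite -g_sigma_preimage_comp; apply: smallest_sub.
  exact: sigma_algebra_measurable.
rewrite -bigcup_seq => B [i _ [C mC <-]].
exact: mf.
Qed.

End rV_measurable.

Section rV_lebesgue.
Context {R : realType}.

Definition rV_cons n (p : measurableTypeR R * 'rV[R]_n) : 'rV[R]_n.+1 :=
  \row_i oapp (p.2 ord0) p.1 (unlift ord0 i).

Definition rV_uncons n (x : 'rV[R]_n.+1) : measurableTypeR R * 'rV[R]_n :=
  (x ord0 ord0, \row_i x ord0 (lift ord0 i)).

Lemma rV_consK n : cancel (@rV_cons n) (@rV_uncons n).
Proof.
move=> [a x]; rewrite /rV_uncons /rV_cons mxE unlift_none /=; congr pair.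
by apply/rowP => i; rewrite !mxE liftK.
Qed.

Lemma measurable_rV_cons n : measurable_fun [set: measurableTypeR R * 'rV[R]_n] (@rV_cons n).
Proof.
apply: measurable_fun_rV => i; rewrite /comp /rV_cons.
under eq_fun do rewrite mxE.
case: (unlift ord0 i) => [j|] /=; last exact: measurable_fst.
exact: (measurableT_comp (measurable_coord j) measurable_snd).
Qed.

Lemma measurable_rV_uncons n : measurable_fun [set: 'rV[R]_n.+1] (@rV_uncons n).
Proof.
apply/measurable_fun_pairP; split; first exact: measurable_coord.
apply: measurable_fun_rV => i; rewrite /comp /rV_uncons /=.
under eq_fun do rewrite mxE.
exact: measurable_coord.
Qed.

Section step.
Context (n : nat) (mu : {sigma_finite_measure set 'rV[R]_n -> \bar R}).

Definition rV_step : set 'rV[R]_n.+1 -> \bar R :=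
  pushforward (lebesgue_measure \x mu)%E (@rV_cons n).

Let step0 : rV_step set0 = 0%E.
Proof. by rewrite /rV_step /pushforward preimage_set0 measure0. Qed.

Let step_ge0 A : (0 <= rV_step A)%E.
Proof. by rewrite /rV_step /pushforward; exact: measure_ge0. Qed.

Let step_sigma_additive : semi_sigma_additive rV_step.
Proof.
pose m := measure_function_pushforward__canonical__measure_function_Measure
  (lebesgue_measure \x mu)%E (@measurable_rV_cons n).
exact: (@measure_semi_sigma_additive _ _ _ m).
Qed.

HB.instance Definition _ := isMeasure.Build _ _ _ rV_step
  step0 step_ge0 step_sigma_additive.

Let step_sigma_finite : sigma_finite setT rV_step.
Proof.
have [F FT Foo] : sigma_finite setT (lebesgue_measure \x mu)%E.
  have /sigma_finiteP[F [TF ndF Foo]] := sigma_finiteT (@lebesgue_measure R).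
  have /sigma_finiteP[G [TG ndG Goo]] := sigma_finiteT mu.
  exists (fun k => F k `*` G k).
    rewrite -setXTT TF TG predeqE => -[x y]; split.
      move=> [/= [k _ Fkx] [l _ Gly]]; exists (maxn k l) => //; split.
      - by move: x Fkx; exact/subsetPset/ndF/leq_maxl.
      - by move: y Gly; exact/subsetPset/ndG/leq_maxr.
    by move=> [k _ []/= ? ?]; split; exists k.
  move=> k; have [? ?] := Foo k; have [? ?] := Goo k.
  split; first exact: measurableX.
  by rewrite product_measure1E// lte_mul_pinfty// ge0_fin_numE.
exists (fun k => @rV_uncons n @^-1` F k).
  by rewrite -preimage_bigcup -FT preimage_setT.
move=> k; have [mF Fk] := Foo k; split.
  by rewrite -[X in measurable X]setTI; exact: measurable_rV_uncons.
rewrite /rV_step /pushforward -comp_preimage.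
by rewrite (_ : _ \o _ = id)//; apply/funext => p /=; rewrite rV_consK.
Qed.

HB.instance Definition _ := Measure_isSigmaFinite.Build _ _ _ rV_step
  step_sigma_finite.

End step.

Fixpoint lebesgue_rV n : {sigma_finite_measure set 'rV[R]_n -> \bar R} :=
  if n is n'.+1 then rV_step (lebesgue_rV n') else dirac (0 : 'rV[R]_0).

Lemma lebesgue_rV_box n (A : 'I_n -> set (measurableTypeR R)) :
  (forall i, measurable (A i)) ->
  lebesgue_rV n [set x | forall i, A i (x ord0 i)] =
  (\prod_(i < n) lebesgue_measure (A i))%E.
Proof.
elim: n A => [|n IH] A mA.
  rewrite big_ord0 /= diracE mem_set //=; by case.
rewrite big_ord_recl -IH//.
rewrite /rV_step /pushforward -product_measure1E//=.
  rewrite -[LHS]/((lebesgue_measure \x lebesgue_rV n)%E (rV_cons (n:=n) @^-1` _)).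
  congr ((lebesgue_measure \x lebesgue_rV n)%E _); apply/seteqP; split=> -[a x] /=.
    move=> h; split; first by have := h ord0; rewrite mxE unlift_none.
    by move=> i; have := h (lift ord0 i); rewrite mxE liftK.
  by move=> [h0 h] i; rewrite mxE; case: unliftP => [j|] -> //=.
rewrite [X in measurable X](_ : _ = \bigcap_(i in [set: 'I_n]) ((fun x : 'rV[R]_n => x ord0 i) @^-1` A (lift ord0 i))); last first.
  apply/seteqP; split => x /= h i; first by move=> _; exact: h.
  exact: (h i I).
apply: fin_bigcap_measurable => // i _.
have := @measurable_coord R n i measurableT _ (mA (lift ord0 i)).
by rewrite setTI.
Qed.

End rV_lebesgue.

Section function_spaces.
Context {R : realType} {n : nat}.
Local Open Scope complex_scope.
Local Notation E := 'rV[R]_n.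
Local Notation mu := (@lebesgue_rV R n).
Implicit Types (u v : E -> R[i]) (p : \bar R).

(* The library's norm on 'rV[R]_n is the sup norm. *)
Definition enorm (x : E) : R := Num.sqrt (\sum_i x ord0 i ^+ 2).

Definition partial (i : 'I_n) (f : E -> R) : E -> R :=
  fun x => 'D_(delta_mx ord0 i) f x.

Fixpoint Ck (k : nat) (f : E -> R) : Prop :=
  if k is k'.+1 then
    continuous f /\
    forall i, (forall x, derivable f x (delta_mx ord0 i)) /\
              Ck k' (partial i f)
  else continuous f.

Definition test_function (phi : E -> R) : Prop :=
  (forall k, Ck k phi) /\ compact (closure [set x | phi x != 0]).

Definition Cb1_holder_real (gamma : R) (f : E -> R) : Prop :=
  [/\ Ck 1 f,
      exists M : R, forall x, `|f x| <= M,
      forall i, exists M : R, forall x, `|partial i f x| <= M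
    & forall i, exists K : R, forall x y,
        `|partial i f x - partial i f y| <= K * enorm (x - y) `^ gamma].

Definition Cb1_holder (gamma : R) u : Prop :=
  Cb1_holder_real gamma (@complex.Re R \o u) /\ Cb1_holder_real gamma (@complex.Im R \o u).

(* Elements of L^p are represented by functions, and equality in L^p is
   expressed as equality almost everywhere. *)
Definition Lp p u : Prop :=
  (@complex.Re R \o u) \in Lfun mu p /\ (@complex.Im R \o u) \in Lfun mu p.

Definition Lp_norm p u : \bar R :=
  Lnorm mu p (fun x => (ComplexField.Normc.normc (u x))%:E).

(* When u and g are in some L^p, both integrands are integrable. *)
Definition weak_partial_real (i : 'I_n) (f g : E -> R) : Prop :=
  forall phi, test_function phi ->
    \int[mu]_x (f x * partial i phi x) = - \int[mu]_x (g x * phi x).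

Definition weak_partial (i : 'I_n) u v : Prop :=
  weak_partial_real i (@complex.Re R \o u) (@complex.Re R \o v) /\
  weak_partial_real i (@complex.Im R \o u) (@complex.Im R \o v).

(* u is in W^{2,p}, with gradient G and Hessian H *)
Definition W2p p u (G : 'I_n -> E -> R[i]) (H : 'I_n -> 'I_n -> E -> R[i]) :
    Prop :=
  [/\ Lp p u,
      forall i, Lp p (G i) /\ weak_partial i u (G i)
    & forall i j, Lp p (H i j) /\ weak_partial j (G i) (H i j)].

End function_spaces.

Section operator.
Context {R : realType} {n : nat}.
Local Open Scope complex_scope.
Local Notation E := 'rV[R]_n.
Local Notation mu := (@lebesgue_rV R n).
Local Notation normc := ComplexField.Normc.normc.
Variables (alpha beta : R) (p : \bar R).
Implicit Types (u v : E -> R[i]).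

Definition diffusion (x : E) : R := 1 + enorm x `^ alpha.
Definition potential (x : E) : R := enorm x `^ beta.

Definition in_domain u (G : 'I_n -> E -> R[i]) (H : 'I_n -> 'I_n -> E -> R[i]) :
    Prop :=
  [/\ W2p p u G H,
      (fun x => diffusion x * Num.sqrt (\sum_i \sum_j normc (H i j x) ^+ 2))
        \in Lfun mu p,
      (fun x => Num.sqrt (diffusion x) *
                Num.sqrt (\sum_i normc (G i x) ^+ 2)) \in Lfun mu p
    & Lp p (fun x => (potential x)%:C * u x)].

(* the graph of A_p: u is in D(A_p) and A_p u = v *)
Definition A_graph u v : Prop :=
  exists G H, in_domain u G H /\
    v = (fun x => (diffusion x)%:C * (\sum_i H i i x) - (potential x)%:C * u x)
      %[ae mu].

End operator.

Section semigroups.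
Context {R : realType} {n : nat}.
Local Open Scope complex_scope.
Local Notation E := 'rV[R]_n.
Local Notation mu := (@lebesgue_rV R n).
Local Notation normc := ComplexField.Normc.normc.
Variable p : \bar R.
Implicit Types (u v : E -> R[i]) (S : (E -> R[i]) -> E -> R[i])
  (T : R -> (E -> R[i]) -> E -> R[i]).

(* Linearity and boundedness make S compatible with equality a.e. *)
Definition bounded_operator S : Prop :=
  [/\ forall u, Lp p u -> Lp p (S u),
      forall (c : R[i]) u v, Lp p u -> Lp p v ->
        S (fun x => c * u x + v x) = (fun x => c * S u x + S v x) %[ae mu]
    & exists M : R, forall u, Lp p u ->
        (Lp_norm p (S u) <= M%:E * Lp_norm p u)%E].

Definition C0_semigroup T : Prop :=
  [/\ forall t, 0 <= t -> bounded_operator (T t),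
      forall u, Lp p u -> T 0 u = u %[ae mu],
      forall s t u, 0 <= s -> 0 <= t -> Lp p u ->
        T (s + t) u = T s (T t u) %[ae mu]
    & forall u, Lp p u ->
        Lp_norm p (fun x => T t u x - u x) @[t --> 0^'+] --> 0%E].

(* The generator of T is the operator with graph A. *)
Definition generates (A : (E -> R[i]) -> (E -> R[i]) -> Prop) T : Prop :=
  forall u v, Lp p u -> Lp p v ->
    A u v <->
    Lp_norm p (fun x => (h^-1)%:C * (T h u x - u x) - v x) @[h --> 0^'+]
      --> 0%E.

Definition sector (theta : R) : set R[i] :=
  [set z | exists r phi, [/\ 0 < r, `|phi| < theta
                           & z = (r * cos phi) +i* (r * sin phi)]].

(* complex differentiability in the operator norm on the open set U *)
Definition holomorphic_on (U : set R[i]) (Z : R[i] -> (E -> R[i]) -> E -> R[i]) :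
    Prop :=
  forall z, U z -> exists2 D, bounded_operator D &
    forall e : R, 0 < e -> exists2 d : R, 0 < d &
      forall h, normc h < d -> U (z + h) -> forall u, Lp p u ->
        (Lp_norm p (fun x => Z (z + h)%R u x - Z z u x - h * D u x)%R
           <= (e * normc h)%:E * Lp_norm p u)%E.

Definition analytic_semigroup T : Prop :=
  exists (theta : R) (Z : R[i] -> (E -> R[i]) -> E -> R[i]),
    [/\ 0 < theta <= pi / 2,
        forall (t : R) u, 0 < t -> Lp p u -> Z t%:C u = T t u %[ae mu]
      & [/\ forall z, sector theta z -> bounded_operator (Z z),
            forall z w u, sector theta z -> sector theta w -> Lp p u ->
              Z (z + w) u = Z z (Z w u) %[ae mu],
            holomorphic_on (sector theta) Z
          & forall (theta' : R) u, 0 < theta' < theta -> Lp p u ->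
              forall e : R, 0 < e -> exists2 d : R, 0 < d &
                forall z, sector theta' z -> normc z < d ->
                  (Lp_norm p (fun x => Z z u x - u x)%R < e%:E)%E]].

(* In R[i], 0 <= z means that z is real and nonnegative. *)
Definition positive_operator S : Prop :=
  forall u, Lp p u ->
    (\forall x \ae mu, 0 <= u x) -> \forall x \ae mu, 0 <= S u x.

End semigroups.

(* Main.v *)
Require Import Defs.
From HB Require Import structures.
From mathcomp Require Import all_boot all_order all_algebra.
From mathcomp Require Import all_classical all_reals all_analysis.
From mathcomp Require Import measurable_realfun ess_sup_inf.
From mathcomp.real_closed Require Import complex.
From mathcomp Require Import ring lra.

(* By analyticity, T_p(t) f lies in the domain of A_p, hence in W^{2,p}, for t > 0.

   Let u_k be the convolution of u with a product kernel of width 2^-k.  The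
   difference of two product kernels at comparable scales telescopes into a sum of
   partial derivatives of compactly supported products, so that, testing the weak
   gradient G of u,
     |u_{k+1}(x') - u_k(x)| <= C 2^{k(N-1)} int_{cube of side ~ 2^-k around x} |G|
   when |x' - x| <= 2^-k.  With Jensen's inequality this one estimate yields both
   the gain of integrability W^{1,p} -> L^{p(1+1/N)}, as the L^{p(1+1/N)} norms of
   u_{k+1} - u_k decay geometrically, and Morrey's inequality: when
   N/p <= 1 - gamma the u_k converge uniformly to a bounded gamma-Hoelder function.
   Applied to u and to its weak gradient, the latter gives W^{2,p} in C_b^{1+gamma}.

   Since T_p(t) = T_q(t/2) T_p(t/2) on functions that T_p(t/2) maps into L^q, the
   gain of integrability can be iterated until p is as large as Morrey's
   inequality requires. *)

Set Implicit Arguments.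
Unset Strict Implicit.
Unset Printing Implicit Defensive.
Import Order.TTheory GRing.Theory Num.Theory.
Import numFieldNormedType.Exports.
Local Open Scope classical_set_scope.
Local Open Scope ring_scope.

(** The measure on R^N is an iterated product, so integrals of product kernels factor into
    one-dimensional ones. A difference of two one-dimensional kernels of mass 1 has a compactly
    supported primitive, which is an admissible factor for testing a weak derivative. This primitive
    is bounded without the factor 2^k that a kernel carries: that is the whole gain of one order of
    smoothness. The exponent p (1 + 1/N) lies below the Sobolev exponent. It is chosen because it
    gives geometric decay for every p > 1, with no separation of the cases p < N, p = N and p > N,
    while the powers of a fixed ratio > 1 still reach every exponent. The limit of the u_k is
    identified with u through integrals over boxes: Fubini moves the mollification onto the
    indicator of the box, and boxes determine a function almost everywhere. For classical
    derivatives, u_k(x + t e_i) - u_k(x) is the integral of the weak derivative against a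
    nonnegative kernel of mass t near x; the Hoelder representative of that derivative evaluates it
    up to a power of t. *)

Section smooth_functions.
Context {R : realType}.
Implicit Types f g : R -> R.

(** The derivatives of all orders are one sequence, so that differentiating shifts it and taking a
    primitive prepends a term, with no induction on the order. *)
Definition smooth f : Prop :=
  exists F : nat -> R -> R, F 0%N = f /\
    forall n x, is_derive x (1 : R) (F n) (F n.+1 x).

(** Meant for the points outside ]0, 1[, where the bump is flat: a quadratic bound settles
    differentiability from both sides at once. *)
Lemma is_derive_quadratic f (x c : R) :
  (forall y, `|f y - f x| <= c * (y - x) ^+ 2) -> is_derive x (1 : R) f 0.
Proof.
move=> fc; have c0 : 0 <= c.
  by have := le_trans (normr_ge0 _) (fc (x + 1)); rewrite addrAC subrr add0r expr1n mulr1.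
have H : h^-1 *: (f (h *: (1 : R) + x) - f x) @[h --> (0:R)^'] --> (0:R).
  apply/cvgr0Pnorm_lt => e e0.
  near=> h.
  have h0 : h != 0 by near: h; exact: nbhs_dnbhs_neq.
  have hn : 0 < `|h| by rewrite normr_gt0.
  rewrite normrZ normfV mulrC ltr_pdivrMr//.
  apply: (le_lt_trans (fc _)).
  rewrite [_ *: _]mulr1 addrK -real_normK ?num_real// expr2 mulrA ltr_pM2r//.
  have : `|h| < e / (c + 1).
    near: h; apply: dnbhs0_lt; apply: divr_gt0 => //; lra.
  rewrite ltr_pdivlMr; last by lra.
  nra.
have ex : derivable f x 1 by apply/cvg_ex; exists 0; exact: H.
by apply: DeriveDef => //; apply/cvg_lim.
Unshelve. all: by end_near. Qed.

Lemma is_derive_continuous f (df : R -> R) :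
  (forall x, is_derive x (1 : R) f (df x)) -> continuous f.
Proof.
by move=> fd x; apply/differentiable_continuous/derivable1_diffP; case: (fd x).
Qed.

Lemma smooth_continuous f : smooth f -> continuous f.
Proof. by move=> [F [<- dF]]; exact: is_derive_continuous (dF 0%N). Qed.

Lemma smooth_derive f df : (forall x, is_derive x (1 : R) f (df x)) ->
  smooth f -> smooth df.
Proof.
move=> fd [F [F0 dF]]; exists (fun n => F n.+1); split => // .
apply/funext => x; have := dF 0%N x; rewrite F0 => -[_ <-].
by case: (fd x).
Qed.

Lemma smooth_primitive f df : (forall x, is_derive x (1 : R) f (df x)) ->
  smooth df -> smooth f.
Proof.
move=> fd [F [F0 dF]]; exists (fun n => if n is m.+1 then F m else f); split => //.
by case=> [|n] x; rewrite ?F0.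
Qed.

Lemma smoothB f g : smooth f -> smooth g -> smooth (fun x => f x - g x).
Proof.
move=> [F [<- dF]] [G [<- dG]]; exists (fun n x => F n x - G n x); split => // n x.
exact: is_deriveB.
Qed.

Lemma is_derive_affine f (df : R) (c a b x : R) :
  is_derive (a * (x - b)) (1 : R) f df ->
  is_derive x (1 : R) (fun x => c * f (a * (x - b))) (c * a * df).
Proof.
move=> fd.
have ad : is_derive x (1 : R) (fun y : R => a * (y - b)) a.
  have := @is_deriveZ _ _ _ (fun y : R => y - b) a x 1 1.
  rewrite [_ *: 1]mulr1; apply.
  rewrite -[X in is_derive _ _ _ X]subr0; exact: is_deriveB.
have fad := @is_derive1_comp _ f (fun y : R => a * (y - b)) x df a fd ad.
rewrite (_ : c * a * df = c *: (df * a)); last by rewrite /GRing.scale/=; ring.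
exact: (@is_deriveZ _ _ _ _ c x 1 _ fad).
Qed.

Lemma smooth_affine f (c a b : R) : smooth f ->
  smooth (fun x => c * f (a * (x - b))).
Proof.
move=> [F [<- dF]]; exists (fun n x => c * a ^+ n * F n (a * (x - b))).
split=> [|n x]; first by apply/funext => x; rewrite expr0 mulr1.
by rewrite exprSr mulrA; apply: is_derive_affine.
Qed.

(** * A smooth bump supported in [0, 1] and the mollifier obtained from it *)

Lemma expR_ge_exprn (n : nat) (s : R) : 0 <= s -> s ^+ n * expR (- s) <= n`!%:R.
Proof.
move=> s0; rewrite expRN -ler_pdivlMr ?invr_gt0 ?expR_gt0// invrK.
case: n => [|n]; first by rewrite expr0 fact0 mul1r; rewrite -expR0 ler_expR.
rewrite -ler_pdivrMl ?ltr0n ?fact_gt0// mulrC.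
by apply: le_trans (expR_ge1Dxn n s0); rewrite lerDr.
Qed.

Lemma poly_bounded01 (p : {poly R}) : exists2 M : R, 0 <= M &
  forall x, 0 < x < 1 -> `|p.[x]| <= M.
Proof.
exists (\sum_(i < size p) `|p`_i|); first by apply: sumr_ge0 => i _; exact: normr_ge0.
move=> x /andP[x0 x1]; rewrite horner_coef.
apply: (le_trans (ler_norm_sum _ _ _)); apply: ler_sum => i _.
rewrite normrM ler_piMr// normrX exprn_ile1// ger0_norm; exact: ltW.
Qed.

Let bumpw : {poly R} := 'X * (1 - 'X).

(* The derivatives of [exp (- 1 / (x (1 - x)))] all have this shape. *)
Definition bump_term (p : {poly R}) (m : nat) (x : R) : R :=
  if 0 < x < 1 then p.[x] * bumpw.[x] ^- m * expR (- bumpw.[x]^-1) else 0.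

(** The numerator that remains when w^-(m+2) exp(-1/w) is factored out of the derivative of p w^-m
    exp(-1/w). *)
Let bump_next (p : {poly R}) (m : nat) : {poly R} :=
  p^`() * bumpw ^+ 2 - m%:R *: (p * bumpw^`() * bumpw) + p * bumpw^`().

Let bumpwE x : bumpw.[x] = x * (1 - x).
Proof. by rewrite /bumpw !hornerE. Qed.

Let bumpw_gt0 x : 0 < x < 1 -> 0 < bumpw.[x].
Proof. by rewrite bumpwE => /andP[? ?]; rewrite mulr_gt0// subr_gt0. Qed.

(** Inside the interval this is the product rule; at any other point the value and the claimed
    derivative vanish, and a bound by a multiple of (y - x)^2 suffices. *)
Lemma is_derive_bump_term p m x :
  is_derive x (1 : R) (bump_term p m) (bump_term (bump_next p m) m.+2 x).
Proof.
have [x01|x01] := boolP (0 < x < 1).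
  have w0 := bumpw_gt0 x01.
  apply: (@near_eq_is_derive _ _ _
    (fun y => p.[y] * bumpw.[y] ^- m * expR (- bumpw.[y]^-1))).
    near=> y; rewrite /bump_term ifT//.
    have : y \in `]0, 1[%R by near: y; apply: near_in_itvoo; rewrite in_itv.
    by rewrite in_itv.
  have wN0 : bumpw.[x] != 0 by rewrite gt_eqF.
  have dw : is_derive x (1 : R) (horner bumpw) bumpw^`().[x] by exact: is_derive_poly.
  have dV := is_deriveV wN0 dw.
  have dE : is_derive x (1 : R) (fun y => expR (- bumpw.[y]^-1))
      (expR (- bumpw.[x]^-1) * - (- bumpw.[x] ^- 2 *: bumpw^`().[x])).
    apply: (@is_derive1_comp _ expR (fun y => - bumpw.[y]^-1)).
  have dX : is_derive x (1 : R) (fun y => bumpw.[y] ^- m)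
     (m%:R * bumpw.[x] ^- m.-1 *: (- bumpw.[x] ^- 2 *: bumpw^`().[x])).
    have -> : (fun y => bumpw.[y] ^- m) = (fun y => bumpw.[y]^-1) ^+ m.
      by apply/funext => y; rewrite -exprVn fctE.
    have := @is_deriveX _ _ (fun y => bumpw.[y]^-1) m x 1 _ dV.
    by rewrite exprVn.
  have dp : is_derive x (1 : R) (horner p) p^`().[x] by exact: is_derive_poly.
  have := is_deriveM (is_deriveM dp dX) dE.
  move=> /is_derive_eq; apply.
  rewrite /bump_term x01 /bump_next.
  move: bumpw wN0 {dw dV dE dX w0} => W wN0.
  rewrite !(hornerD, hornerN, hornerZ, hornerM, horner_exp) fctE /GRing.scale/=.
  move: (expR (- W.[x]^-1)) (W.[x]) wN0 (W^`().[x]) (p.[x]) (p^`().[x]) => e w w0 w' q q'.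
  case: m => [|m]/=.
    rewrite expr0 !exprS expr0; field.
    exact: w0.
  have wm : w ^+ m != 0 by rewrite expf_neq0.
  rewrite !exprS -natr1; field.
  by rewrite w0 wm.
have bx : bump_term p m x = 0 by rewrite /bump_term (negbTE x01).
have -> : bump_term (bump_next p m) m.+2 x = 0 by rewrite /bump_term (negbTE x01).
have [M M0 pM] := poly_bounded01 p.
apply: (@is_derive_quadratic _ _ (M * (m.+2)`!%:R)) => y; rewrite bx subr0 /bump_term.
case: ifPn => [y01|_]; last by rewrite normr0 mulr_ge0 ?sqr_ge0// mulr_ge0.
have w0 := bumpw_gt0 y01.
(* As x lies outside ]0, 1[, the weight y (1 - y) is at most the distance from y to x. *)
have wxy : bumpw.[y] ^+ 2 <= (y - x) ^+ 2.
  rewrite -[leRHS]real_normK ?num_real// ler_pXn2r ?nnegrE ?normr_ge0 ?(ltW w0)//.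
  rewrite bumpwE; move: x01 y01; rewrite negb_and -!leNgt => /orP[x0|x1] /andP[y0 y1].
    by rewrite ger0_norm; nra.
  by rewrite ler0_norm; nra.
rewrite !normrM (ger0_norm (expR_ge0 _)) (ger0_norm (x := _ ^- _)); last first.
  by rewrite invr_ge0 exprn_ge0// ltW.
rewrite -mulrA; apply: (@le_trans _ _ (M * ((m.+2)`!%:R * bumpw.[y] ^+ 2))); last first.
  by rewrite -mulrA ler_wpM2l// ler_wpM2l.
apply: ler_pM => //; [|exact: pM|].
  by rewrite mulr_ge0 ?expR_ge0// invr_ge0 exprn_ge0// ltW.
(* With s = 1/w, the power m + 2 absorbs w^-m and leaves the factor w^2 that [wxy] controls. *)
have := @expR_ge_exprn m.+2 (bumpw.[y]^-1).
rewrite invr_ge0 => /(_ (ltW w0)).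
move=> h; apply: le_trans (ler_wpM2r (exprn_ge0 2 (ltW w0)) h).
rewrite le_eqVlt; apply/orP; left; apply/eqP.
rewrite mulrAC exprVn; congr (_ * _).
rewrite -[m.+2]addn2 exprD invfM -mulrA mulVf ?mulr1//.
by rewrite expf_neq0// gt_eqF.
Unshelve. all: by end_near. Qed.

Lemma smooth_bump_term p m : smooth (bump_term p m).
Proof.
pose G := fix G n := if n is n'.+1 then (bump_next (G n').1 (G n').2, (G n').2.+2) else (p, m).
exists (fun n => bump_term (G n).1 (G n).2); split => // n x.
exact: is_derive_bump_term.
Qed.

Lemma continuous_primitive0 f : continuous f -> (forall x, x <= 0 -> f x = 0) ->
  exists2 F : R -> R, forall x, is_derive x (1 : R) F (f x) &
    forall x, x <= 0 -> F x = 0.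
Proof.
(* Starting at -1 rather than 0 keeps x = 0 in the interior of the interval to which the fundamental
   theorem is applied. *)
move=> cf f0; pose F x := (\int[lebesgue_measure]_(t in `[(-1)%R, x]) f t)%R.
have F0 x : x <= 0 -> F x = 0.
  move=> x0; rewrite /F (@eq_Rintegral _ _ _ _ _ (cst 0)).
    by rewrite Rintegral_cst// mul0r.
  move=> y; rewrite inE/= in_itv/= => /andP[_ yx]; apply: f0.
  exact: le_trans x0.
exists F => // x; have [x0|x0] := ltP x 0.
  rewrite f0 ?ltW//; apply: (@near_eq_is_derive _ _ _ (cst 0)).
  near=> y; rewrite F0//; apply: ltW; near: y; exact: lt_nbhsl.
have [] := @continuous_FTC1_closed R f (-1) x (x + 1).
- by rewrite ltrDl.
- apply: continuous_compact_integrable; first exact: segment_compact.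
  exact: continuous_subspaceT.
- lra.
- exact: cf.
by move=> dF; rewrite derive1E => <-; apply/derivableP.
Unshelve. all: by end_near. Qed.

Lemma bounded_of_support01 f (c : R) : continuous f -> (forall x, x <= 0 -> f x = 0) ->
  (forall x, 1 <= x -> f x = c) -> exists2 M : R, 0 < M & forall x, `|f x| <= M.
Proof.
move=> cf f0 f1.
have cnf : {within `[0, 1], continuous (fun x => `|f x|)}.
  by apply: continuous_subspaceT => x; apply: continuous_comp; [exact: cf|exact: norm_continuous].
have [d _ dM] := EVT_max ler01 cnf.
exists (`|f d| + 1) => [|x]; first by rewrite ltr_wpDl.
apply: (@le_trans _ _ `|f d|); last by rewrite lerDl.
have [x0|x0] := leP x 0; first by rewrite f0// normr0.
have [x1|x1] := leP 1 x; last by apply: dM; rewrite in_itv/= !ltW.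
by rewrite f1// -(f1 1)//; apply: dM; rewrite in_itv/= ler01 lexx.
Qed.

(** [rho] is the bump divided by its mass and serves as kernel; its primitive [P], a smooth step
    from 0 to 1, yields primitives of differences of kernels; the second primitive [S] computes the
    integrals of those primitives. *)
Lemma mollifier_exists : exists rho P S : R -> R, exists M : R,
  [/\ smooth rho, forall x, is_derive x (1 : R) P (rho x),
      forall x, is_derive x (1 : R) S (P x)
    & [/\ forall x, x <= 0 -> [/\ rho x = 0, P x = 0 & S x = 0],
        forall x, 1 <= x -> [/\ rho x = 0, P x = 1 & S x = S 1 + (x - 1)],
        0 < M, forall x, `|rho x| <= M /\ `|P x| <= M
      & forall x, 0 <= rho x]].
Proof.
pose b : R -> R := bump_term 1 0.
have sb : smooth b by exact: smooth_bump_term.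
have b0 x : x <= 0 -> b x = 0 by move=> x0; rewrite /b /bump_term ltNge x0.
have b1 x : 1 <= x -> b x = 0 by move=> x0; rewrite /b /bump_term [x < 1]ltNge x0 andbF.
have [B dB B0] := continuous_primitive0 (smooth_continuous sb) b0.
have cB := is_derive_continuous dB.
have B1_gt0 : 0 < B 1.
  have [y y01] := MVT ltr01 (fun x _ => dB x) (continuous_subspaceT cB).
  rewrite (B0 0)// !subr0 mulr1 => ->; rewrite /b /bump_term.
  move: y01; rewrite in_itv/= => ->.
  by rewrite expr0 invr1 mulr1 hornerE mul1r expR_gt0.
have B1 x : 1 <= x -> B x = B 1.
  move=> x1; have [y y1x ] := MVT_segment x1 (fun x _ => dB x) (continuous_subspaceT cB).
  rewrite b1; last by move: y1x; rewrite in_itv/= => /andP[].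
  by rewrite mul0r => /eqP; rewrite subr_eq0 => /eqP.
pose rho x := (B 1)^-1 * b (1 * (x - 0)); pose P x := (B 1)^-1 * B (1 * (x - 0)).
have srho : smooth rho by exact: smooth_affine.
have dP x : is_derive x (1 : R) P (rho x).
  rewrite /rho -[(B 1)^-1]mulr1; apply: is_derive_affine; exact: dB.
have P0 x : x <= 0 -> P x = 0 by move=> x0; rewrite /P mul1r subr0 (B0 _ x0) mulr0.
have P1 x : 1 <= x -> P x = 1.
  by move=> x0; rewrite /P mul1r subr0 (B1 _ x0) mulVf// gt_eqF.
have cP := is_derive_continuous dP.
have [S dS S0] := continuous_primitive0 cP P0.
have cS := is_derive_continuous dS.
have rho0 x : x <= 0 -> rho x = 0 by move=> x0; rewrite /rho mul1r subr0 (b0 _ x0) mulr0.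
have rho1 x : 1 <= x -> rho x = 0 by move=> x0; rewrite /rho mul1r subr0 (b1 _ x0) mulr0.
have [M1 M10 rhoM] := bounded_of_support01 (smooth_continuous srho) rho0 rho1.
have [M2 M20 PM] := bounded_of_support01 cP P0 P1.
exists rho, P, S, (M1 + M2); split => //; split.
- by move=> x x0; split; [exact: rho0|exact: P0|exact: S0].
- move=> x x1; split; [exact: rho1|exact: P1|].
  have [y] := MVT_segment x1 (fun x _ => dS x) (continuous_subspaceT cS).
  rewrite in_itv/= => /andP[y1 _]; rewrite P1// mul1r => <-; ring.
- exact: addr_gt0.
- move=> x; split.
    by apply: (le_trans (rhoM x)); rewrite lerDl ltW.
  by apply: (le_trans (PM x)); rewrite lerDr ltW.
- move=> x; rewrite /rho mulr_ge0 ?invr_ge0 ?(ltW B1_gt0)// /b /bump_term.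
  by case: ifP => // _; rewrite expr0 invr1 mulr1 hornerE mul1r expR_ge0.
Qed.

Local Notation mu1 := (@lebesgue_measure R).

Lemma integral_itv_derive f F (a b : R) : a <= b -> continuous f ->
  (forall x, is_derive x (1 : R) F (f x)) ->
  \int[mu1]_(x in `[a, b]) f x = F b - F a.
Proof.
move=> ab cf dF; have cF := is_derive_continuous dF.
move: ab; rewrite le_eqVlt => /predU1P[->|ab]; first by rewrite set_itv1 Rintegral_set1 subrr.
rewrite /Rintegral (@continuous_FTC2 _ f F)//.
- exact: continuous_subspaceT.
- split.
  + by move=> x _; case: (dF x).
  + by apply: cvg_at_right_filter; exact: cF.
  + by apply: cvg_at_left_filter; exact: cF.
- by move=> x _; rewrite derive1E; case: (dF x).
Qed.

End smooth_functions.

(** * Products of one-variable functions: derivatives, supports and integrals *)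

Section product_functions.
Context {R : realType}.
Local Notation mu1 := (@lebesgue_measure R).

Definition prodf n (f : 'I_n -> R -> R) (x : 'rV[R]_n) : R :=
  \prod_i f i (x ord0 i).

Definition updf n (f : 'I_n -> R -> R) (i : 'I_n) (g : R -> R) (j : 'I_n) : R -> R :=
  if j == i then g else f j.

Section calculus.
Variable n : nat.
Implicit Types (f : 'I_n -> R -> R).

Lemma prodf_upd f i g x :
  prodf (updf f i g) x = g (x ord0 i) * \prod_(j | j != i) f j (x ord0 j).
Proof.
rewrite /prodf (bigD1 i)//= /updf eqxx; congr (_ * _).
by apply: eq_bigr => j /negbTE ->.
Qed.

Lemma updf_id f i : updf f i (f i) = f.
Proof. by apply/funext => j; rewrite /updf; case: eqP => [->|]. Qed.

Lemma continuous_prodf f : (forall i, continuous (f i)) -> continuous (prodf f).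
Proof.
move=> cf x.
have -> : prodf f = \prod_(i < n) (fun x : 'rV[R]_n => f i (x ord0 i)).
  by apply/funext => y; rewrite fct_prodE.
elim/big_ind : _ => [|g h cg ch|i _].
- exact: cst_continuous.
- exact: continuousM.
- apply: (continuous_comp (f := fun x : 'rV[R]_n => x ord0 i)); last exact: cf.
  exact: coord_continuous.
Qed.

Lemma is_derive_prodf f i df (x : 'rV[R]_n) :
  is_derive (x ord0 i) (1 : R) (f i) df ->
  is_derive x (delta_mx ord0 i) (prodf f) (df * \prod_(j | j != i) f j (x ord0 j)).
Proof.
move=> [exf <-].
set c := \prod_(j | j != i) _.
have E h : h^-1 *: (prodf f (h *: delta_mx ord0 i + x) - prodf f x) =
    (h^-1 *: (f i (h *: (1 : R) + x ord0 i) - f i (x ord0 i))) * c.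
  rewrite -scalerAl; congr (_ *: _).
  rewrite -{1 2}(updf_id f i) !prodf_upd !mxE !eqxx [h *: (1 : R)]mulr1 mulr1 mulrBl.
  congr (_ * _ - _); apply: eq_bigr => j /negbTE ji.
  by rewrite !mxE eqxx ji mulr0 add0r.
have C : (h^-1 *: (prodf f (h *: delta_mx ord0 i + x) - prodf f x))
    @[h --> (0:R)^'] --> 'D_1 (f i) (x ord0 i) * c.
  under eq_fun do rewrite E.
  by apply: cvgMl; exact: exf.
have ex : derivable (prodf f) x (delta_mx ord0 i) by apply/cvg_ex; eexists; exact: C.
by apply: DeriveDef => //; apply/cvg_lim.
Qed.

Lemma partial_prodf f i df : (forall x, is_derive x (1 : R) (f i) (df x)) ->
  partial i (prodf f) = prodf (updf f i df).
Proof.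
move=> dfi; apply/funext => x; rewrite prodf_upd /partial.
by have [] := is_derive_prodf (dfi (x ord0 i)).
Qed.

Lemma Ck_prodf k f : (forall i, smooth (f i)) -> Ck k (prodf f).
Proof.
elim: k f => [|k IH] f sf /=.
  by apply: continuous_prodf => i; exact: smooth_continuous.
split; first by apply: continuous_prodf => i; exact: smooth_continuous.
move=> i; have [F [F0 dF]] := sf i.
have dfi x : is_derive x (1 : R) (f i) (F 1%N x) by rewrite -F0.
split=> [x|]; first by have [] := is_derive_prodf (dfi (x ord0 i)).
rewrite (partial_prodf dfi); apply: IH => j.
by rewrite /updf; case: eqP => _; [exact: smooth_derive (sf i)|exact: sf].
Qed.

Lemma prodf_support f (a b : 'I_n -> R) (x : 'rV[R]_n) :
  (forall i s, f i s != 0 -> a i <= s <= b i) -> prodf f x != 0 ->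
  forall i, a i <= x ord0 i <= b i.
Proof.
move=> fab + i; rewrite -(updf_id f i) prodf_upd mulf_eq0 negb_or => /andP[+ _].
exact: fab.
Qed.

Lemma test_function_prodf f (a b : 'I_n -> R) :
  (forall i, smooth (f i)) -> (forall i s, f i s != 0 -> a i <= s <= b i) ->
  test_function (prodf f).
Proof.
move=> sf fab; split; first by move=> k; exact: Ck_prodf.
pose K := [set x : 'rV[R]_n | forall i, `[a i, b i]%classic (x ord0 i)].
have cK : compact K by apply: (@rV_compact _ _ (fun i => `[a i, b i]%classic)) => i; exact: segment_compact.
have clK : closed K by apply: compact_closed => //; exact: norm_hausdorff.
apply: (subclosed_compact _ cK); first exact: closed_closure.
rewrite [X in _ `<=` X](closure_id _).1//; apply: closureS => x /= /(prodf_support fab) h i.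
by rewrite /= in_itv/=.
Qed.

Lemma prodf_bound f (M : R) (x : 'rV[R]_n) : (forall i, `|f i (x ord0 i)| <= M) ->
  `|prodf f x| <= M ^+ n.
Proof.
move=> fM; rewrite /prodf normr_prod -[n in M ^+ n](card_ord n) -prodr_const.
by apply: ler_prod => i _; rewrite normr_ge0 fM.
Qed.

Lemma measurable_prodf f : (forall i, measurable_fun setT (f i)) ->
  measurable_fun setT (prodf f).
Proof.
move=> mf; apply: measurable_prod => i _.
exact: (measurableT_comp (mf i) (measurable_coord i)).
Qed.

End calculus.

Lemma integrable_mul_prod d1 d2 (T1 : measurableType d1) (T2 : measurableType d2)
    (m1 : {sigma_finite_measure set T1 -> \bar R})
    (m2 : {sigma_finite_measure set T2 -> \bar R}) (f : T1 -> R) (g : T2 -> R) :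
  m1.-integrable setT (EFin \o f) -> m2.-integrable setT (EFin \o g) ->
  (m1 \x m2)%E.-integrable setT (EFin \o (fun z => f z.1 * g z.2)).
Proof.
move=> fi gi.
have /measurable_int /measurable_EFinP mf := fi.
have /measurable_int /measurable_EFinP mg := gi.
pose F (z : T1 * T2) : R := f z.1 * g z.2.
have mF : measurable_fun setT F.
  apply: measurable_funM; first exact: (measurableT_comp mf measurable_fst).
  exact: (measurableT_comp mg measurable_snd).
apply/integrable12ltyP; first exact/measurable_EFinP.
have /integrableP[_ /=] := gi; set I := integral _ _ _ => Ilty.
have I0 : (0 <= I)%E by exact: integral_ge0.
have If : (fine I)%:E = I by rewrite fineK// ge0_fin_numE.
have E1 x : (\int[m2]_y `|(EFin \o F) (x, y)| = (fine I)%:E * `|(f x)%:E|)%E.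
  transitivity (\int[m2]_y (`|f x|%:E * `|g y|%:E))%E.
    by apply: eq_integral => y _; rewrite /F/= normrM EFinM.
  rewrite ge0_integralZl_EFin//=; last first.
    by apply/measurable_EFinP; exact: measurableT_comp.
  by rewrite If muleC.
under eq_integral do rewrite E1.
rewrite ge0_integralZl_EFin//=; last 2 first.
- by apply/measurable_EFinP; exact: measurableT_comp.
- exact: fine_ge0.
by rewrite lte_mul_pinfty ?lee_fin ?fine_ge0//; have /integrableP[] := fi.
Qed.

Lemma integral_prodf n (f : 'I_n -> R -> R) :
  (forall i, mu1.-integrable setT (EFin \o f i)) ->
  (lebesgue_rV n).-integrable setT (EFin \o prodf f) /\
  \int[lebesgue_rV n]_x prodf f x = \prod_i \int[mu1]_s f i s.
Proof.
elim: n f => [|n IH] f fi.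
  rewrite big_ord0 (_ : prodf f = cst 1); last first.
    by apply/funext => x; rewrite /prodf big_ord0.
  have mT : lebesgue_rV 0 [set: 'rV[R]_0] = 1%E by rewrite /= diracE mem_set.
  split; last by rewrite Rintegral_cst// mul1r; exact: (congr1 fine mT).
  exact: finite_measure_integrable_cst.
have [ig Eg] := IH (fun i => f (lift ord0 i)) (fun i => fi _).
set g := prodf _ in ig Eg.
pose m : {measure set (measurableTypeR R * 'rV[R]_n) -> \bar R} :=
  (lebesgue_measure \x lebesgue_rV n)%E.
pose F (z : measurableTypeR R * 'rV[R]_n) : R := f ord0 z.1 * g z.2.
have iF : m.-integrable setT (EFin \o F) by exact: integrable_mul_prod.
have FE : (EFin \o prodf f) \o (@rV_cons R n) = EFin \o F.
  apply/funext => -[a x] /=; rewrite /prodf /F big_ord_recl /= mxE unlift_none/=.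
  congr ((_ * _)%:E); apply: eq_bigr => i _; by rewrite mxE liftK.
have mpf : measurable_fun setT (EFin \o prodf f).
  apply/measurable_EFinP; apply: measurable_prodf => i.
  by have /measurable_int /measurable_EFinP := fi i.
(* As a set function [pm] is [lebesgue_rV n.+1], packaged as a pushforward of [m]. *)
pose pm := measure_function_pushforward__canonical__measure_function_Measure
  m (@measurable_rV_cons R n).
have iP : pm.-integrable setT (EFin \o prodf f).
  apply: integrable_pushforward => //; first exact: measurable_rV_cons.
  by rewrite FE preimage_setT.
have EP : (\int[lebesgue_rV n.+1]_x (EFin \o prodf f) x = \int[m]_z (F z)%:E)%E.
  transitivity (\int[pm]_x (EFin \o prodf f) x)%E.
    by apply: eq_measure_integral => A mA _.
  rewrite (integral_pushforward (@measurable_rV_cons R n) mpf)//.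
    by rewrite FE preimage_setT.
  by rewrite FE preimage_setT.
split.
  apply/integrableP; split => //; have /integrableP[_] := iP.
  apply: le_lt_trans; rewrite le_eqVlt; apply/orP; left; apply/eqP.
  by apply: eq_measure_integral => A mA _.
rewrite big_ord_recl -Eg [LHS]/Rintegral EP -integral12_prod_meas1//.
have Ig : (\int[lebesgue_rV n]_x (g x)%:E = (\int[lebesgue_rV n]_x g x)%:E)%E.
  by rewrite /Rintegral fineK//; exact: integrable_fin_num.
have E2 x : fubini_F (lebesgue_rV n) (EFin \o F) x =
    (f ord0 x * \int[lebesgue_rV n]_x g x)%:E.
  rewrite /fubini_F EFinM -Ig -integralZl//.
under eq_integral do rewrite E2.
by rewrite -RintegralZr.
Qed.

End product_functions.

(** * Integral inequalities on a general measure space *)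

Section integral_bounds.
Context d (T : measurableType d) (R : realType).
Variable mu : {measure set T -> \bar R}.
Implicit Types (f u phi : T -> R) (B : set T).

Lemma Lfun_powR_integrable f (p : R) : 0 < p -> measurable_fun setT f ->
  mu.-integrable setT (fun x => (`|f x| `^ p)%:E) -> f \in Lfun mu p%:E.
Proof.
move=> p0 mf /integrableP[_ fi]; rewrite inE; apply/andP; split; rewrite inE//=.
rewrite /finite_norm unlock; apply: poweR_lty.
by apply: le_lt_trans fi; under [leRHS]eq_integral => x _ do rewrite gee0_abs ?lee_fin ?powR_ge0//.
Qed.

Lemma integrable_cst_on (c : R) B : measurable B -> (mu B < +oo)%E ->
  mu.-integrable B (EFin \o cst c).
Proof.
move=> mB Boo; apply/integrableP; split; first exact/measurable_EFinP/measurable_cst.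
by rewrite (_ : (fun x => _) = cst `|c|%:E)// integral_cst// lte_mul_pinfty.
Qed.

Lemma Lfun_measurable f p : f \in Lfun mu p -> measurable_fun setT f.
Proof. by rewrite inE => /andP[]; rewrite inE. Qed.

Lemma Lfun_ae_le f g (p : R) : 1 <= p -> measurable_fun setT f ->
  g \in Lfun mu p%:E -> {ae mu, forall x, `|f x| <= `|g x|} ->
  f \in Lfun mu p%:E.
Proof.
move=> p1 mf gp fg; have p0 : 0 < p := lt_le_trans ltr01 p1.
apply: Lfun_powR_integrable => //.
have /integrableP[mgp goo] := Lfun_integrable p1 gp.
have mfp : measurable_fun setT (fun x => (`|f x| `^ p)%:E).
  apply/measurable_EFinP; apply: (measurableT_comp (measurable_powR _)).
  exact: measurableT_comp.
apply/integrableP; split; [exact: mfp|apply: le_lt_trans goo].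
apply: ae_ge0_le_integral => //.
- exact: measurableT_comp.
- exact: measurableT_comp.
- apply: filterS fg => x fgx _.
  rewrite /= lee_fin.
  rewrite !(ger0_norm (powR_ge0 _ _)).
  by apply: ge0_ler_powR; rewrite ?nnegrE ?(ltW p0).
Qed.

(** On a set of finite measure the function 1 + |f|^p is integrable, and it dominates |f|. *)
Lemma Lfun_integrable_on f (p : R) B : 1 <= p -> f \in Lfun mu p%:E ->
  measurable B -> (mu B < +oo)%E -> mu.-integrable B (EFin \o f).
Proof.
move=> p1 fp mB Boo; have mf := Lfun_measurable fp.
have fpi := Lfun_integrable p1 fp.
have i1 : mu.-integrable B (EFin \o (fun x => 1 + `|f x| `^ p)).
  have fpB : mu.-integrable B (EFin \o (fun x => `|f x| `^ p)) by exact: integrableS fpi.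
  exact: (integrableD mB (integrable_cst_on 1 mB Boo) fpB).
apply: le_integrable i1 => //.
  by apply/measurable_EFinP; exact: measurable_funTS.
move=> x _; rewrite /= lee_fin [leRHS]ger0_norm; last by rewrite addr_ge0// powR_ge0.
have [f1|f1] := leP `|f x| 1; first by rewrite (le_trans f1)// lerDl powR_ge0.
rewrite (@le_trans _ _ (`|f x| `^ p))//; last by rewrite lerDr.
by rewrite -[leLHS]powRr1// ler_powR// ltW.
Qed.

(** Jensen's inequality for the mean over [B], cleared of denominators; a null [B], which has no
    mean value, is settled first. *)
Lemma Rintegral_powR_le f (p : R) B : 1 < p -> f \in Lfun mu p%:E ->
  measurable B -> (mu B < +oo)%E ->
  (\int[mu]_(x in B) `|f x|) `^ p <=
  fine (mu B) `^ (p - 1) * \int[mu]_(x in B) `|f x| `^ p.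
Proof.
move=> p1 fp mB Boo.
have p0 : 0 < p by rewrite (lt_trans ltr01).
have fi := integrable_norm (Lfun_integrable_on (ltW p1) fp mB Boo).
have fpi : mu.-integrable B (EFin \o (fun x => `|f x| `^ p)).
  by apply: integrableS (Lfun_integrable (ltW p1) fp).
set A := Rintegral _ _ _; set I := Rintegral _ _ _.
have A0 : 0 <= A by apply: Rintegral_ge0.
have m0 : 0 <= fine (mu B) by apply: fine_ge0.
have [m_eq0|m_neq0] := eqVneq (fine (mu B)) 0.
  have -> : A = 0.
    rewrite /A /Rintegral null_set_integral//.
    - exact: measurable_int fi.
    - by move/eqP: m_eq0; rewrite fine_eq0 ?ge0_fin_numE// => /eqP.
  by rewrite powR0 ?gt_eqF// mulr_ge0 ?powR_ge0// Rintegral_ge0// => x _; exact: powR_ge0.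
have m_gt0 : 0 < fine (mu B) by rewrite lt_neqAle eq_sym m_neq0.
set m := fine (mu B) in m0 m_neq0 m_gt0 *.
(* Young's inequality against the constant [b], the mean value of [`|f|] on [B] *)
pose b := A / m.
have b0 : 0 <= b by rewrite divr_ge0.
have q0 : 0 < p / (p - 1) by rewrite divr_gt0// subr_gt0.
have young x : `|f x| * b `^ (p - 1) <= `|f x| `^ p / p + b `^ p / (p / (p - 1)).
  have := @conjugate_powR R `|f x| (b `^ (p - 1)) p (p / (p - 1)).
  rewrite powR_ge0 -powRrM mulrCA mulfV ?mulr1 ?subr_eq0 ?gt_eqF//; apply => //.
  by field; rewrite subr_eq0 !gt_eqF.
have : \int[mu]_(x in B) (`|f x| * b `^ (p - 1)) <=
       \int[mu]_(x in B) (`|f x| `^ p / p + b `^ p / (p / (p - 1))).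
  apply: le_Rintegral => //.
  - exact: (integrableZr mB _ fi).
  - exact: (integrableD mB (integrableZr mB _ fpi) (integrable_cst_on _ mB Boo)).
rewrite RintegralZr// RintegralD//; last 2 first.
- exact: (integrableZr mB _ fpi).
- exact: integrable_cst_on.
rewrite RintegralZr// Rintegral_cst// -/A -/I -/m.
have AE : A = b * m by rewrite /b divfK.
have bp : b `^ p = b * b `^ (p - 1).
  have [->|bN0] := eqVneq b 0; first by rewrite powR0 ?gt_eqF// mul0r.
  by rewrite -[X in X * _]powRr1// -powRD; [congr (_ `^ _); ring|rewrite bN0 implybT].
have mp : m `^ p = m * m `^ (p - 1).
  by rewrite -[X in X * _]powRr1// -powRD; [congr (_ `^ _); ring|rewrite m_neq0 implybT].
rewrite AE => h; have : b `^ p * m <= I.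
  have -> : b `^ p * m = p * (b * m * b `^ (p - 1) - b `^ p / (p / (p - 1)) * m).
    by rewrite bp; field; rewrite subr_eq0 !gt_eqF.
  by rewrite -ler_pdivlMl// lerBlDr [p^-1 * _]mulrC; exact: h.
clearbody b => h2; rewrite powRM// mp mulrA mulrC ler_wpM2l ?powR_ge0//.
Qed.

Lemma integral_scale_indic (r : R) B : 0 <= r -> measurable B ->
  (\int[mu]_x (r * \1_B x)%:E = r%:E * mu B)%E.
Proof.
move=> r0 mB; under eq_integral do rewrite EFinM.
by rewrite ge0_integralZl_EFin// ?integral_indic ?setIT//; exact/measurable_EFinP.
Qed.

Lemma integral_indic_mul f B : measurable B -> mu.-integrable B (EFin \o f) ->
  mu.-integrable setT (EFin \o (fun x => \1_B x * f x)) /\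
  \int[mu]_x (\1_B x * f x) = \int[mu]_(x in B) f x.
Proof.
move=> mB fi.
have -> : (fun x => \1_B x * f x) = f \_ B.
  by apply/funext => x; rewrite patchE indicE; case: ifPn => _; rewrite ?mul1r ?mul0r.
split; last by rewrite -Rintegral_mkcond.
by rewrite -restrict_EFin; exact/(integrable_mkcond _ mB).
Qed.

Lemma Rintegral_mul_bound u phi B (C : R) : measurable B ->
  measurable_fun setT u -> mu.-integrable B (EFin \o u) ->
  measurable_fun setT phi -> (forall x, `|phi x| <= C) ->
  (forall x, ~ B x -> phi x = 0) ->
  mu.-integrable setT (EFin \o (fun x => u x * phi x)) /\
  `|\int[mu]_x (u x * phi x)| <= C * \int[mu]_(x in B) `|u x|.
Proof.
move=> mB mu_ iu mphi phiC phi0.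
have C0 (x : T) : 0 <= C := le_trans (normr_ge0 _) (phiC x).
have iup : mu.-integrable B (EFin \o (fun x => u x * phi x)).
  apply: (@le_integrable _ _ _ _ _ mB _ (fun x => (C%:E * (EFin \o u) x)%E)).
  - by apply/measurable_EFinP/measurable_funTS/measurable_funM.
  - by move=> x _; rewrite /= lee_fin !normrM mulrC ler_wpM2r// (le_trans (phiC x))// ler_norm.
  - exact: integrableZl.
have E : (fun x => u x * phi x) = (fun x => u x * phi x) \_ B.
  apply/funext => x; rewrite patchE; case: ifPn => // /negP; rewrite inE => /phi0 ->.
  by rewrite mulr0.
split.
  by rewrite E -restrict_EFin; exact/(integrable_mkcond _ mB).
rewrite E -Rintegral_mkcond; apply: (le_trans (le_normr_Rintegral mB iup)).
rewrite -RintegralZl//; last exact: integrable_norm.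
apply: le_Rintegral => //; first exact: integrable_norm.
  exact: (integrableZl mB _ (integrable_norm iu)).
by move=> x _; rewrite normrM mulrC ler_wpM2r.
Qed.

End integral_bounds.

(** * Domination and convergence of series with geometrically small terms *)

Section geometric_domination.
Context d (T : measurableType d) (R : realType).
Variable mu : {measure set T -> \bar R}.

(* With [t = sqrt theta], the weighted sum [S = \sum_k t^-k |v_k|^q] is integrable
   and [|v_k| <= S^(1/q) (t^(1/q))^k]. *)
Lemma geometric_domination (v : (T -> R)^nat) (q A theta : R) :
  0 < q -> 0 <= A -> 0 < theta < 1 -> (forall k, measurable_fun setT (v k)) ->
  (forall k, (\int[mu]_x (`|v k x| `^ q)%:E <= (A * theta ^+ k)%:E)%E) ->
  exists h : T -> R, h \in Lfun mu q%:E /\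
    {ae mu, forall x, (forall m, `|\sum_(k < m) v k x| <= h x) /\
                      cvgn (fun m => \sum_(k < m) v k x)}.
Proof.
move=> q0 A0 /andP[th0 th1] mv vA.
(* One factor t^k of theta^k pays for the weight t^-k, the other sums the series. *)
pose t := Num.sqrt theta.
have t0 : 0 < t by rewrite sqrtr_gt0.
have tt : t * t = theta by rewrite -expr2 sqr_sqrtr// ltW.
have t1 : t < 1 by rewrite -sqrtr1 ltr_sqrt.
pose w k x : R := t ^- k * `|v k x| `^ q.
have w0 k x : 0 <= w k x by rewrite mulr_ge0 ?powR_ge0// invr_ge0 exprn_ge0// ltW.
have mvq k : measurable_fun setT (fun x => `|v k x| `^ q).
  apply: (measurableT_comp (measurable_powR q)).
  exact: measurableT_comp.
have mw k : measurable_fun setT (EFin \o w k).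
  by apply/measurable_EFinP; apply: measurable_funM.
pose S x := (\sum_(k <oo) (w k x)%:E)%E.
have S0 x : (0 <= S x)%E by apply: nneseries_ge0 => k _ _; rewrite lee_fin.
have mS : measurable_fun setT S.
  by apply: (@ge0_emeasurable_sum _ _ _ _ (fun k => EFin \o w k) xpredT) => // k x _ _; rewrite lee_fin.
have iS : mu.-integrable setT S.
  apply/integrableP; split => //.
  under eq_integral do rewrite gee0_abs//.
  rewrite integral_nneseries//; last by move=> k x _; rewrite lee_fin.
  apply: (@le_lt_trans _ _ (A * (1 - t)^-1)%:E); last exact: ltry.
  apply: lime_le; first by apply: is_cvg_nneseries => k _ _; apply: integral_ge0 => x _; rewrite lee_fin.
  apply: nearW => m.
  apply: (@le_trans _ _ (\sum_(0 <= k < m) (A * t ^+ k)%:E)%E); last first.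
    rewrite sumEFin lee_fin.
    by apply: (@geometric_le_lim _ m A t A0 t0); rewrite gtr0_norm.
  apply: lee_sum => k _.
  under eq_integral do rewrite EFinM.
  rewrite ge0_integralZl_EFin//; last 2 first.
  - exact/measurable_EFinP.
  - by rewrite invr_ge0 exprn_ge0// ltW.
  have tk : 0 <= t ^- k by rewrite invr_ge0 exprn_ge0// ltW.
  apply: (le_trans (lee_wpmul2l _ (vA k))); first by rewrite lee_fin.
  rewrite -EFinM lee_fin -tt exprMn.
  by rewrite le_eqVlt; apply/orP; left; apply/eqP; field; rewrite expf_neq0// gt_eqF.
pose kap := t `^ q^-1.
have kap0 : 0 < kap by exact: powR_gt0.
have kap1 : kap < 1.
  have := @gt0_ltr_powR R q^-1 _ t 1; rewrite invr_gt0 !nnegrE (ltW t0) ler01 powR1.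
  by apply.
pose h x := (fine (S x)) `^ q^-1 * (1 - kap)^-1.
have mh : measurable_fun setT h.
  apply: measurable_funM => //; apply: (measurableT_comp (measurable_powR _)).
  exact: (measurableT_comp (fine_measurable measurableT)).
exists h; split.
  apply: Lfun_powR_integrable => //.
  pose c := (1 - kap)^-1 `^ q.
  apply: (@le_integrable _ _ _ mu _ measurableT _ (fun x => c%:E * S x)%E).
  - apply/measurable_EFinP; apply: (measurableT_comp (measurable_powR _)).
    exact: measurableT_comp.
  - move=> x _ /=; rewrite ger0_norm ?powR_ge0// .
    rewrite /h normrM !ger0_norm ?powR_ge0 ?invr_ge0 ?subr_ge0 ?(ltW kap1)//.
    rewrite powRM ?powR_ge0 ?invr_ge0 ?subr_ge0 ?(ltW kap1)//.
    rewrite -powRrM mulVf ?gt_eqF// powRr1 ?fine_ge0// -/c.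
    have c0 : 0 <= c by exact: powR_ge0.
    rewrite gee0_abs; last by rewrite mule_ge0 ?lee_fin.
    rewrite mulrC EFinM lee_wpmul2l ?lee_fin//.
    by move: (S0 x); case: (S x) => [s| |] //= _; rewrite ?leey.
  - exact: integrableZl.
have := integrable_ae measurableT iS.
apply: filterS => x /= /(_ I) Sfin.
have vk k : `|v k x| <= fine (S x) `^ q^-1 * kap ^+ k.
  have wS : w k x <= fine (S x).
    rewrite -lee_fin fineK//.
    apply: (@le_trans _ _ (\sum_(0 <= i < k.+1) (w i x)%:E)%E).
      by rewrite big_nat_recr//= leeDr// sume_ge0// => i _; rewrite lee_fin.
    by apply: nneseries_lim_ge => i _ _; rewrite lee_fin.
  have {}wS : `|v k x| `^ q <= fine (S x) * t ^+ k.
    by rewrite -ler_pdivrMr ?exprn_gt0// mulrC.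
  have := @ge0_ler_powR R q^-1 _ _ _ _ _ wS; rewrite !nnegrE powR_ge0 invr_ge0 (ltW q0).
  rewrite mulr_ge0 ?exprn_ge0 ?fine_ge0 ?(ltW t0)// => /(_ isT isT isT).
  rewrite -powRrM mulfV ?gt_eqF// powRr1// powRM ?fine_ge0 ?exprn_ge0 ?(ltW t0)//.
  rewrite /kap -(powR_mulrn k (ltW t0)) -powRrM.
  by rewrite -(powR_mulrn k (powR_ge0 _ _)) -powRrM mulrC [q^-1 * _]mulrC mulrC.
split.
  move=> m; apply: (le_trans (ler_norm_sum _ _ _)).
  apply: (le_trans (ler_sum _ (fun (k : 'I_m) _ => vk k))).
  have := @geometric_le_lim _ m (fine (S x) `^ q^-1) kap (powR_ge0 _ _) kap0.
  rewrite gtr0_norm// => /(_ kap1); rewrite /h; apply: le_trans.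
  by rewrite /series/= big_mkord.
have -> : (fun m => \sum_(k < m) v k x) = series (v ^~ x).
  by apply/funext => m; rewrite /series/= big_mkord.
apply: normed_cvg.
apply: (@series_le_cvg _ _ (geometric (fine (S x) `^ q^-1) kap)) => //.
- by move=> k /=.
- by move=> k; rewrite /= mulr_ge0 ?powR_ge0 ?exprn_ge0 ?(ltW kap0).
- by apply: is_cvg_geometric_series; rewrite gtr0_norm.
Qed.

End geometric_domination.

(** * Cubes, compactly supported products and the telescoping identity *)

Section cubes.
Context {R : realType} (n : nat).
Local Notation mu := (@lebesgue_rV R n).
Implicit Types (x y : 'rV[R]_n) (c : R) (u : 'rV[R]_n -> R).

Definition cube x c : set 'rV[R]_n := [set y | forall i, `|y ord0 i - x ord0 i| <= c].

Let cubeE x c : cube x c =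
  [set y | forall i, `[x ord0 i - c, x ord0 i + c]%classic (y ord0 i)].
Proof.
by apply/seteqP; split => y /= h i; have := h i; rewrite /= in_itv/= ler_distl.
Qed.

Lemma measurable_cube x c : measurable (cube x c).
Proof.
rewrite cubeE [X in measurable X](_ : _ = \bigcap_(i in [set: 'I_n])
    ((fun y : 'rV[R]_n => y ord0 i) @^-1` `[x ord0 i - c, x ord0 i + c]%classic)).
  apply: fin_bigcap_measurable => // i _.
  by rewrite -[X in measurable X]setTI; apply: measurable_coord.
by apply/seteqP; split => y /= h i; [move=> _|]; exact: h.
Qed.

Lemma lebesgue_cube x c : 0 <= c -> mu (cube x c) = ((2 * c) ^+ n)%:E.
Proof.
move=> c0; have -> : mu (cube x c) =
    (\prod_(i < n) @lebesgue_measure R `[(x ord0 i - c)%R, (x ord0 i + c)%R])%E.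
  rewrite cubeE; apply: lebesgue_rV_box => i; exact: measurable_itv.
under eq_bigr => i _.
  rewrite lebesgue_measure_itv/= lte_fin.
  rewrite (_ : (if _ then _ else _) = (2 * c)%:E); last first.
    case: ifPn => [_|]; first by rewrite -EFinB; congr EFin; ring.
    rewrite -leNgt => h; congr EFin; lra.
  over.
by rewrite prodEFin prodr_const card_ord.
Qed.

Lemma lebesgue_cube_lty x c : (mu (cube x c) < +oo)%E.
Proof.
have [c0|c0] := leP 0 c; first by rewrite lebesgue_cube// ltry.
apply: le_lt_trans (ltry ((2 * 1) ^+ n)); rewrite -(lebesgue_cube x)//.
apply: le_measure; rewrite ?inE; [exact: measurable_cube..|].
by move=> y /= h i; rewrite (le_trans (h i))// (le_trans (ltW c0)).
Qed.

Definition locally_integrable_rV u : Prop :=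
  measurable_fun setT u /\ forall x c, mu.-integrable (cube x c) (EFin \o u).

Lemma Lfun_locally_integrable u (p : R) : 1 <= p -> u \in Lfun mu p%:E ->
  locally_integrable_rV u.
Proof.
move=> p1 up; split; first exact: Lfun_measurable up.
move=> x c; apply: Lfun_integrable_on p1 up _ _; first exact: measurable_cube.
exact: lebesgue_cube_lty.
Qed.

Lemma prodf_cube0 (f : 'I_n -> R -> R) x c :
  (forall i s, f i s != 0 -> `|s - x ord0 i| <= c) ->
  forall y, ~ cube x c y -> prodf f y = 0.
Proof.
move=> fs y yc; apply: contra_notP yc => /eqP f0 i /=.
move: f0; rewrite -(updf_id f i) prodf_upd mulf_eq0 negb_or => /andP[/fs].
by [].
Qed.

Lemma smooth_measurable (f : R -> R) : smooth f -> measurable_fun setT f.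
Proof. by move=> /smooth_continuous; exact: continuous_measurable_fun. Qed.

Lemma Rintegral_prodf_bound u (f : 'I_n -> R -> R) x c (C : R) :
  locally_integrable_rV u -> (forall i, measurable_fun setT (f i)) ->
  (forall i s, f i s != 0 -> `|s - x ord0 i| <= c) ->
  (forall y, `|prodf f y| <= C) ->
  mu.-integrable setT (EFin \o (fun y => u y * prodf f y)) /\
  `|\int[mu]_y (u y * prodf f y)| <= C * \int[mu]_(y in cube x c) `|u y|.
Proof.
move=> [mu_ iu] mf fs fC; apply: Rintegral_mul_bound => //.
- exact: measurable_cube.
- exact: measurable_prodf.
- exact: prodf_cube0.
Qed.

Section telescoping.
Variables (a b sigma : 'I_n -> R -> R).

(** The test function of the i-th telescoping step: its i-th partial derivative is the difference of
    two consecutive hybrids of [a] and [b]. *)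
Definition prodf_mix (i j : 'I_n) : R -> R :=
  if (j < i)%N then a j else if j == i then sigma j else b j.

(* [prodf a - prodf b] telescopes, replacing one factor [b i] by [a i] at a
   time, and each step is a partial derivative of a compactly supported product. *)
Lemma weak_partial_telescope u (G : 'I_n -> 'rV[R]_n -> R)
    (z : 'rV[R]_n) (c K : R) :
  (forall i, smooth (a i)) -> (forall i, smooth (b i)) ->
  (forall i s, is_derive s (1 : R) (sigma i) (a i s - b i s)) ->
  (forall i s, a i s != 0 -> `|s - z ord0 i| <= c) ->
  (forall i s, b i s != 0 -> `|s - z ord0 i| <= c) ->
  (forall i s, sigma i s != 0 -> `|s - z ord0 i| <= c) ->
  (forall i s, `|a i s| <= K) -> (forall i s, `|b i s| <= K) ->
  locally_integrable_rV u -> (forall i, weak_partial_real i u (G i)) ->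
  \int[mu]_y (u y * prodf a y) - \int[mu]_y (u y * prodf b y) =
  - \sum_i \int[mu]_y (G i y * prodf (prodf_mix i) y).
Proof.
move=> sa sb dsig asupp bsupp ssupp aK bK lu wG.
have ssig i : smooth (sigma i).
  by apply: smooth_primitive (dsig i) _; exact: smoothB.
(* The hybrids, running from [b] at m = 0 to [a] at m = n. *)
pose h (m : nat) (j : 'I_n) := if (j < m)%N then a j else b j.
have hsupp m i s : h m i s != 0 -> `|s - z ord0 i| <= c.
  by rewrite /h; case: ifP => _; [exact: asupp|exact: bsupp].
have sh m i : smooth (h m i) by rewrite /h; case: ifP.
have ih m : mu.-integrable setT (EFin \o (fun y => u y * prodf (h m) y)).
  apply: (@Rintegral_prodf_bound _ (h m) z c (K ^+ n) lu _ _ _).1.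
  - by move=> i; exact: smooth_measurable.
  - exact: hsupp.
  - by move=> y; apply: prodf_bound => i; rewrite /h; case: ifP.
pose I m := \int[mu]_y (u y * prodf (h m) y).
have step (i : 'I_n) : I i.+1 - I i = - \int[mu]_y (G i y * prodf (prodf_mix i) y).
  have smix j : smooth (prodf_mix i j) by rewrite /prodf_mix; case: ifP => // _; case: ifP.
  rewrite -(wG i (prodf (prodf_mix i))); last first.
    apply: (@test_function_prodf _ _ _ (fun j => z ord0 j - c) (fun j => z ord0 j + c) smix).
    move=> j s; rewrite -ler_distl /prodf_mix.
    by case: ifP => _; [exact: asupp|case: ifP => _; [exact: ssupp|exact: bsupp]].
  rewrite /I -RintegralB//; apply: eq_Rintegral => y _.
  have dmix s : is_derive s (1 : R) (prodf_mix i i) (a i s - b i s).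
    by rewrite /prodf_mix ltnn eqxx.
  rewrite (partial_prodf dmix).
  rewrite -mulrBr; congr (_ * _).
  rewrite -(updf_id (h i.+1) i) -[h i](updf_id (h i) i) !prodf_upd.
  have Er (f : 'I_n -> R -> R) : (forall j, j != i -> f j = prodf_mix i j) ->
      \prod_(j | j != i) f j (y ord0 j) = \prod_(j | j != i) prodf_mix i j (y ord0 j).
    by move=> fE; apply: eq_bigr => j ji; rewrite fE.
  rewrite !Er; last 2 first.
  - move=> j ji; rewrite /h /prodf_mix (negbTE ji).
    by case: ltnP.
  - move=> j ji; rewrite /h /prodf_mix (negbTE ji) ltnS leq_eqVlt.
    by rewrite (_ : (nat_of_ord j == i) = false)//; apply/negbTE.
  by rewrite -mulrBl /h ltnn ltnSn.
have -> : \int[mu]_y (u y * prodf a y) = I n.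
  by rewrite /I (_ : h n = a)//; apply/funext => j; rewrite /h ltn_ord.
have -> : \int[mu]_y (u y * prodf b y) = I 0%N.
  by rewrite /I (_ : h 0%N = b)//; apply/funext => j.
rewrite -(telescope_sumr I (leq0n n)) big_mkord -sumrN.
by apply: eq_bigr => i _; exact: step.
Qed.

End telescoping.
End cubes.

(** * Half-open boxes and almost everywhere equality *)

Section boxes.
Context {R : realType} (n : nat).
Local Notation mu := (@lebesgue_rV R n).
Implicit Types (a b : 'I_n -> R) (w : 'rV[R]_n -> R).

(** Open on the left and closed on the right, because differences of rescaled steps [P] converge
    pointwise to the indicator of exactly this interval, endpoints included. *)
Definition obox a b : set 'rV[R]_n := [set y | forall i, a i < y ord0 i <= b i].

Lemma measurable_obox a b : measurable (obox a b).
Proof.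
rewrite [X in measurable X](_ : _ = \bigcap_(i in [set: 'I_n])
    ((fun y : 'rV[R]_n => y ord0 i) @^-1` `]a i, b i]%classic)).
  apply: fin_bigcap_measurable => // i _.
  by rewrite -[X in measurable X]setTI; apply: measurable_coord.
apply/seteqP; split => y /= h i; first by move=> _; rewrite /= in_itv/=; exact: h.
by have := h i I; rewrite /= in_itv.
Qed.

Lemma obox_sub_cube a b : obox a b `<=` cube 0 (\sum_i (`|a i| + `|b i|)).
Proof.
move=> y /= h i; rewrite mxE subr0 (bigD1 i)//=.
have s0 : 0 <= \sum_(j | j != i) (`|a j| + `|b j|) by rewrite sumr_ge0// => j _; rewrite addr_ge0.
have /andP[h1 h2] := h i.
have := ler_norm (b i); have := ler_norm (- a i); rewrite normrN => a1 b1.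
have := normr_ge0 (a i); have := normr_ge0 (b i).
by rewrite ler_norml => *; apply/andP; split; lra.
Qed.

Let oboxes : set (set 'rV[R]_n) := [set A | exists a b, A = obox a b].

Let oboxesI : setI_closed oboxes.
Proof.
move=> _ _ [a [b ->]] [a' [b' ->]].
exists (fun i => Num.max (a i) (a' i)), (fun i => Num.min (b i) (b' i)).
apply/seteqP; split => y /=.
  by move=> [h h'] i; rewrite gt_max le_min; have /andP[-> ->] := h i; have /andP[-> ->] := h' i.
by move=> h; split => i; have := h i; rewrite gt_max le_min => /andP[/andP[? ?] /andP[? ?]]; apply/andP.
Qed.

(** A slab in one coordinate is the union of the boxes that cut the other coordinates at -k and k;
    hence boxes generate the product sigma-algebra. *)
Let coord_oboxes (i : 'I_n) :
  @measurable_fun _ _ (g_sigma_algebraType oboxes) (measurableTypeR R) setT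
    (fun x : 'rV[R]_n => x ord0 i).
Proof.
apply: (@measurability _ _ _ (measurableTypeR R) setT _ (@ocitv R) erefl).
move=> _ [_ [[s t] _ <-] <-]; rewrite setTI.
rewrite (_ : _ @^-1` _ = \bigcup_k obox (fun j => if j == i then s else - k%:R)
                                   (fun j => if j == i then t else k%:R)).
  apply: bigcup_measurable => k _; apply: sub_sigma_algebra.
  by do 2 eexists.
apply/seteqP; split => y /=.
  rewrite in_itv/= => yi.
  pose K := (Num.truncn (\sum_j `|y ord0 j|)).+1.
  have yK j : `|y ord0 j| < K%:R.
    apply: le_lt_trans (truncnS_gt _).
    by rewrite (bigD1 j)//= lerDl sumr_ge0.
  exists K => // j /=; case: eqP => [->//|_].
  by have := yK j; rewrite ltr_norml => /andP[-> /ltW ->].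
by move=> [k _ /(_ i)]; rewrite eqxx in_itv.
Qed.

Lemma measurable_oboxes : @measurable _ 'rV[R]_n = <<s oboxes >>.
Proof.
apply/seteqP; split; last first.
  apply: smallest_sub; first exact: sigma_algebra_measurable.
  by move=> _ [a [b ->]]; exact: measurable_obox.
apply: smallest_sub; first exact: smallest_sigma_algebra.
rewrite -bigcup_seq => A [i _ [Y mY <-]].
exact: (coord_oboxes i measurableT mY).
Qed.

(** Boxes form a generating pi-system. Inside each box [Q k] a Dynkin argument extends the vanishing
    of the integral to all measurable subsets, so [w] is null there, and the [Q k] exhaust the
    space. *)
Lemma ae_eq0_obox w : measurable_fun setT w ->
  (forall x c, mu.-integrable (cube x c) (EFin \o w)) ->
  (forall a b, (forall i, a i <= b i) -> \int[mu]_(x in obox a b) w x = 0) ->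
  {ae mu, forall x, w x = 0}.
Proof.
move=> mw iw w0.
have iwb a b : mu.-integrable (obox a b) (EFin \o w).
  apply: integrableS (iw 0 (\sum_i (`|a i| + `|b i|))).
  - exact: measurable_cube.
  - exact: measurable_obox.
  - exact: obox_sub_cube.
have w0b a b : (\int[mu]_(x in obox a b) (w x)%:E = 0)%E.
  have [ab|/existsNP[i abi]] := pselect (forall i, a i <= b i).
    have := w0 a b ab; rewrite /Rintegral => E.
    rewrite -[LHS]fineK ?E//; apply: integrable_fin_num => //; exact: measurable_obox.
  rewrite (_ : obox a b = set0) ?integral_set0//.
  by apply/seteqP; split => // y /(_ i) /andP[? ?]; apply: abi; lra.
pose Q k := obox (fun=> - (k%:R : R)) (fun=> k%:R).
have H k A : measurable A -> (\int[mu]_(x in A `&` Q k) (w x)%:E = 0)%E.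
  have mQ : measurable (Q k) by exact: measurable_obox.
  rewrite measurable_oboxes => sA.
  apply: (@dynkin_induction _ _ oboxes
    (fun A => \int[mu]_(x in A `&` Q k) (w x)%:E = 0)%E measurable_oboxes oboxesI) sA.
  - by rewrite setTI; exact: w0b.
  - move=> B GB; have GQ : oboxes (Q k) by do 2 eexists.
    by have [a [b ->]] := oboxesI GB GQ; exact: w0b.
  - move=> S mS S0.
    have := w0b (fun=> - (k%:R : R)) (fun=> k%:R); rewrite -/(Q k).
    rewrite -{1}(setTI (Q k)) -(setUv S) setIUl integral_setU//.
    + by rewrite S0 add0e.
    + exact: measurableI.
    + by apply: measurableI => //; exact: measurableC.
    + by apply/measurable_EFinP; exact: measurable_funTS.
    + by apply/disj_setPS => y /= [[Sy _] [nSy _]].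
  - move=> F mF tF F0.
    rewrite setI_bigcupl integral_bigcup.
    + by apply: eseries0 => i _ _; exact: F0.
    + by apply: trivIset_setIr.
    + by move=> i; exact: measurableI.
    + apply: integrableS (iwb (fun=> - (k%:R : R)) (fun=> k%:R)) => //.
      * by rewrite -setI_bigcupl; apply: measurableI => //; exact: bigcupT_measurable.
      * by move=> y [i _ []].
have ae k : {ae mu, forall x, Q k x -> w x = 0}.
  have mQ : measurable (Q k) by exact: measurable_obox.
  have : ae_eq mu (Q k) (EFin \o w) (cst 0%E).
    apply: integral_ae_eq => //; first exact: iwb.
    move=> E EQ mE; rewrite integral0 -(H k E mE); congr integral.
    by apply/esym/setIidPl.
  by apply: filterS => x + Qx => /(_ Qx) [].
have : {ae mu, forall x k, Q k x -> w x = 0} by apply/ae_foralln.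
apply: filterS => x hx.
pose K := (Num.truncn (\sum_j `|x ord0 j|)).+1.
apply: (hx K) => j.
have : `|x ord0 j| < K%:R.
  apply: le_lt_trans (truncnS_gt _).
  by rewrite (bigD1 j)//= lerDl sumr_ge0.
by rewrite ltr_norml => /andP[-> /ltW ->].
Qed.

End boxes.

(** * Mollification at dyadic scales *)

Section mollification.
Context {R : realType} (n : nat) (rho P : R -> R) (M : R).
Local Notation mu := (@lebesgue_rV R n).
Implicit Types (x y : 'rV[R]_n) (u : 'rV[R]_n -> R) (s : R) (k l : nat).

Record is_mollifier : Prop := IsMollifier {
  moll_smooth : smooth rho;
  moll_derive : forall s, is_derive s (1 : R) P (rho s);
  moll_le0 : forall s, s <= 0 -> rho s = 0 /\ P s = 0;
  moll_ge1 : forall s, 1 <= s -> rho s = 0 /\ P s = 1;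
  moll_ge0 : forall s, 0 <= rho s;
  moll_gt0 : 0 < M;
  moll_bound : forall s, `|rho s| <= M /\ `|P s| <= M
}.

Hypothesis rhoP : is_mollifier.

Definition ker k (x y : R) : R := 2 ^+ k * rho (2 ^+ k * (y - x)).

(* An antiderivative in [y] of [ker l x' y - ker k x y], with compact support. *)
Definition dker k l (x x' y : R) : R :=
  P (2 ^+ l * (y - x')) - P (2 ^+ k * (y - x)).

Definition mol u k x : R := \int[mu]_y (u y * prodf (fun i => ker k (x ord0 i)) y).

Lemma exp2_gt0 k : 0 < 2 ^+ k :> R. Proof. by rewrite exprn_gt0. Qed.

Lemma smooth_ker k s : smooth (ker k s).
Proof. by apply: smooth_affine; exact: moll_smooth rhoP. Qed.

Lemma ker_support k s s' : ker k s s' != 0 -> s < s' < s + 2 ^- k.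
Proof.
have k0 := exp2_gt0 k.
move=> kN0; apply/andP; split; rewrite ltNge; apply: contra kN0 => h.
  rewrite /ker (moll_le0 rhoP _).1 ?mulr0// pmulr_rle0// subr_le0 //.
rewrite /ker (moll_ge1 rhoP _).1 ?mulr0// -ler_pdivrMl// mulr1 lerBrDl //.
Qed.

Lemma ker_bound k s s' : `|ker k s s'| <= M * 2 ^+ k.
Proof.
rewrite /ker normrM ger0_norm ?(ltW (exp2_gt0 k))// mulrC ler_wpM2r ?(ltW (exp2_gt0 k))//.
exact: (moll_bound rhoP _).1.
Qed.

Lemma is_derive_P k s s' :
  is_derive s' (1 : R) (fun r : R => P (2 ^+ k * (r - s))) (ker k s s').
Proof.
have := is_derive_affine 1 (moll_derive rhoP (2 ^+ k * (s' - s))).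
by rewrite mul1r; under eq_fun do rewrite mul1r.
Qed.

Lemma is_derive_dker k l s s' (y : R) :
  is_derive y (1 : R) (dker k l s s') (ker l s' y - ker k s y).
Proof. by apply: is_deriveB; exact: is_derive_P. Qed.

(** Far from s the two copies of [P] are both 0 or both 1, and cancel. *)
Lemma dker_support k l s s' (y : R) : (k <= l)%N -> `|s' - s| <= 2 ^- k ->
  dker k l s s' y != 0 -> `|y - s| <= 2 * 2 ^- k.
Proof.
move=> kl ss'; have k0 := exp2_gt0 k; have l0 := exp2_gt0 l.
have lk : 2 ^- l <= 2 ^- k :> R by rewrite lef_pV2 ?posrE// ler_eXn2l// ltr1n.
move: ss'; rewrite ler_distl => /andP[s1 s2].
apply: contra_neqT; rewrite -ltNge lter_normr => /orP[h|h].
  rewrite /dker (moll_ge1 rhoP _).2; last by rewrite -ler_pdivrMl// mulr1; lra.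
  by rewrite (moll_ge1 rhoP _).2 ?subrr// -ler_pdivrMl// mulr1; lra.
have kp : 0 < 2 ^- k :> R by rewrite invr_gt0.
rewrite /dker (moll_le0 rhoP _).2; last by rewrite pmulr_rle0//; lra.
by rewrite (moll_le0 rhoP _).2 ?subrr// pmulr_rle0//; lra.
Qed.

Lemma dker_bound k l s s' (y : R) : `|dker k l s s' y| <= 2 * M.
Proof.
apply: (le_trans (ler_normB _ _)); rewrite mulr2n mulrDl mul1r lerD//;
  exact: (moll_bound rhoP _).2.
Qed.

(** In each telescoping term one kernel is replaced by a primitive bounded by 2 M, and only the n -
    1 remaining kernels cost a factor 2^k. The scale may change while the centre moves, so that one
    bound covers refinement (x' = x) as well as translation (l = k). *)
Lemma mol_diff u (G : 'I_n -> 'rV[R]_n -> R) k l x x' : (k <= l <= k.+1)%N ->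
  locally_integrable_rV u -> (forall i, locally_integrable_rV (G i)) ->
  (forall i, weak_partial_real i u (G i)) ->
  (forall i, `|x' ord0 i - x ord0 i| <= 2 ^- k) ->
  `|mol u l x' - mol u k x| <=
  (2 * M) ^+ n * (2 ^+ k) ^+ n.-1 * \sum_i \int[mu]_(y in cube x (2 * 2 ^- k)) `|G i y|.
Proof.
move=> /andP[kl lk] lu lG wG xx'.
have k0 := exp2_gt0 k; have kp : 0 < 2 ^- k :> R by rewrite invr_gt0.
have M0 := moll_gt0 rhoP.
have lek : 2 ^- l <= 2 ^- k :> R by rewrite lef_pV2 ?posrE ?exp2_gt0// ler_eXn2l// ltr1n.
have kb i s : `|ker k (x ord0 i) s| <= 2 * M * 2 ^+ k.
  apply: (le_trans (ker_bound _ _ _)); rewrite ler_wpM2r ?(ltW k0)//; lra.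
(* At l = k + 1 the kernel is twice as high, which accounts for 2 M in place of M. *)
have lb i s : `|ker l (x' ord0 i) s| <= 2 * M * 2 ^+ k.
  apply: (le_trans (ker_bound _ _ _)); rewrite [2 * M]mulrC -mulrA ler_wpM2l ?(ltW M0)//.
  by rewrite -exprS ler_eXn2l// ltr1n.
have ks i s : ker k (x ord0 i) s != 0 -> `|s - x ord0 i| <= 2 * 2 ^- k.
  by move=> /ker_support /andP[h1 h2]; rewrite ler_distl; apply/andP; split; lra.
have ls i s : ker l (x' ord0 i) s != 0 -> `|s - x ord0 i| <= 2 * 2 ^- k.
  move=> /ker_support /andP[h1 h2]; have := xx' i; rewrite !ler_distl => /andP[h3 h4].
  by apply/andP; split; lra.
have ds i s : dker k l (x ord0 i) (x' ord0 i) s != 0 -> `|s - x ord0 i| <= 2 * 2 ^- k.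
  exact: dker_support.
have := weak_partial_telescope (fun i => smooth_ker l (x' ord0 i))
  (fun i => smooth_ker k (x ord0 i))
  (fun i s => is_derive_dker k l (x ord0 i) (x' ord0 i) s) ls ks ds lb kb lu wG.
rewrite -/(mol u l x') -/(mol u k x) => ->.
rewrite normrN (le_trans (ler_norm_sum _ _ _))// mulr_sumr ler_sum// => i _.
set f := prodf_mix _ _ _ i.
have fs j s : f j s != 0 -> `|s - x ord0 j| <= 2 * 2 ^- k.
  by rewrite /f /prodf_mix; case: ifP => _; [exact: ls|case: ifP => _; [exact: ds|exact: ks]].
apply: (@Rintegral_prodf_bound _ _ _ f x (2 * 2 ^- k) _ (lG i) _ fs _).2.
  move=> j; apply: smooth_measurable; rewrite /f /prodf_mix.
  case: ifP => _; first exact: smooth_ker.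
  case: ifP => _; last exact: smooth_ker.
  by apply: (smooth_primitive (is_derive_dker _ _ _ _)); apply: smoothB; exact: smooth_ker.
move=> y; rewrite -(updf_id f i) prodf_upd normrM.
rewrite {1}/f /prodf_mix ltnn eqxx.
have n0 : (0 < n)%N by case: (n) i {f fs} => [[]|].
have -> : (2 * M) ^+ n = 2 * M * (2 * M) ^+ n.-1 by rewrite -exprS prednK.
rewrite -mulrA ler_pM ?normr_ge0// ?dker_bound//.
rewrite -exprMn normr_prod.
have -> : n.-1 = #|[pred j : 'I_n | j != i]|.
  by rewrite -[in LHS](card_ord n) (cardD1 i) /= ; apply: eq_card => j; rewrite !inE andbT.
rewrite -prodr_const; apply: ler_prod => j ji; rewrite normr_ge0/=.
by rewrite /f /prodf_mix (negbTE ji); case: ifP => _; [exact: lb|exact: kb].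
Qed.

Lemma mol_bound u k x : locally_integrable_rV u ->
  `|mol u k x| <= (M * 2 ^+ k) ^+ n * \int[mu]_(y in cube x (2 * 2 ^- k)) `|u y|.
Proof.
move=> lu; apply: (@Rintegral_prodf_bound _ _ _ (fun i => ker k (x ord0 i)) x _ _ lu _ _ _).2.
- by move=> j; apply: smooth_measurable; exact: smooth_ker.
- have kp : 0 < 2 ^- k :> R by rewrite invr_gt0 exp2_gt0.
  by move=> i s /ker_support /andP[h1 h2]; rewrite ler_distl; apply/andP; split; lra.
- by move=> y; apply: prodf_bound => i; exact: ker_bound.
Qed.

Lemma joint_measurable_mol u k : measurable_fun setT u ->
  measurable_fun setT (fun z : 'rV[R]_n * 'rV[R]_n =>
    u z.2 * prodf (fun i => ker k (z.1 ord0 i)) z.2).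
Proof.
move=> mu_; apply: measurable_funM; first exact: (measurableT_comp mu_ measurable_snd).
apply: measurable_prod => i _; rewrite /ker.
apply: measurable_funM => //.
apply: (measurableT_comp (smooth_measurable (moll_smooth rhoP))).
apply: measurable_funM => //; apply: measurable_funB.
  exact: (measurableT_comp (measurable_coord i) measurable_snd).
exact: (measurableT_comp (measurable_coord i) measurable_fst).
Qed.

Lemma measurable_mol u k : measurable_fun setT u -> measurable_fun setT (mol u k).
Proof.
move=> mu_.
pose F (z : 'rV[R]_n * 'rV[R]_n) := (u z.2 * prodf (fun i => ker k (z.1 ord0 i)) z.2)%:E.
have mF : measurable_fun setT F by apply/measurable_EFinP; exact: joint_measurable_mol.
(* The integral is split into the positive and negative parts of [F], since Tonelli's theorem gives
   measurability for each. *)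
have -> : mol u k = fun x => fine (\int[mu]_y F^\+ (x, y) - \int[mu]_y F^\- (x, y))%E.
  apply/funext => x; rewrite /mol /Rintegral integralE.
  by congr (fine (_ - _)%E); apply: eq_integral => y _; rewrite ?funeposE ?funenegE.
apply: (measurableT_comp (fine_measurable measurableT)).
apply: emeasurable_funB; apply: measurable_fun_fubini_tonelli_F => //.
  exact: measurable_funepos.
exact: measurable_funeneg.
Qed.

Let near_diagonal (c : R) :=
  [set z : 'rV[R]_n * 'rV[R]_n | forall i, `|z.2 ord0 i - z.1 ord0 i| <= c].

Let measurable_near_diagonal c : measurable (near_diagonal c).
Proof.
rewrite [X in measurable X](_ : _ = \bigcap_(i in [set: 'I_n])
  ((fun z : 'rV[R]_n * 'rV[R]_n => `|z.2 ord0 i - z.1 ord0 i|) @^-1` `]-oo, c]%classic)).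
  apply: fin_bigcap_measurable => // i _.
  rewrite -[X in measurable X]setTI.
  have : measurable_fun setT (fun z : 'rV[R]_n * 'rV[R]_n => `|z.2 ord0 i - z.1 ord0 i|).
    apply: measurableT_comp => //; apply: measurable_funB.
      exact: (measurableT_comp (measurable_coord i) measurable_snd).
    exact: (measurableT_comp (measurable_coord i) measurable_fst).
  by apply.
by apply/seteqP; split => y /= H i; [move=> _|]; have := H i; rewrite /= in_itv/= => //; apply.
Qed.

Section cube_average.
Variables (h : 'rV[R]_n -> R) (c : R).
Hypotheses (mh : measurable_fun setT h) (h0 : forall y, 0 <= h y).

Let F (z : 'rV[R]_n * 'rV[R]_n) : \bar R := (h z.2 * \1_(near_diagonal c) z)%:E.

Let mF : measurable_fun setT F.
Proof.
apply/measurable_EFinP/measurable_funM; first exact: (measurableT_comp mh measurable_snd).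
exact: measurable_indic.
Qed.

Let F0 z : (0 <= F z)%E. Proof. by rewrite lee_fin mulr_ge0. Qed.

Let integral_F x : (\int[mu]_(y in cube x c) (h y)%:E = \int[mu]_y F (x, y))%E.
Proof.
rewrite integral_mkcond; apply: eq_integral => y _.
rewrite /F patchE indicE/= (_ : (y \in cube x c) = ((x, y) \in near_diagonal c)).
  by case: (_ \in near_diagonal c); rewrite ?mulr1 ?mulr0.
by apply/idP/idP; rewrite !in_setE.
Qed.

Lemma measurable_cube_average :
  measurable_fun setT (fun x => \int[mu]_(y in cube x c) (h y)%:E)%E.
Proof.
rewrite (_ : (fun x => _) = fun x => (\int[mu]_y F (x, y))%E); last first.
  by apply/funext => x; exact: integral_F.
exact: (measurable_fun_fubini_tonelli_F F).
Qed.

(** After exchanging the integrals, each y is counted for the x whose cube contains it; by symmetry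
    these x form the cube around y, of volume (2 c)^n. *)
Lemma integral_cube_average : 0 <= c ->
  (\int[mu]_x \int[mu]_(y in cube x c) (h y)%:E =
   ((2 * c) ^+ n)%:E * \int[mu]_y (h y)%:E)%E.
Proof.
move=> c0; under eq_integral do rewrite integral_F.
rewrite (fubini_tonelli (m1 := mu) (m2 := mu) F mF F0).
transitivity (\int[mu]_y (((2 * c) ^+ n)%:E * (h y)%:E))%E.
  apply: eq_integral => y _; rewrite -(lebesgue_cube y c0) muleC.
  rewrite -(integral_scale_indic mu (h0 y) (measurable_cube y c)).
  apply: eq_integral => x _; rewrite /F/= !indicE; congr (_ * (nat_of_bool _)%:R)%:E.
  by apply/idP/idP; rewrite !in_setE => H i; rewrite distrC; exact: H.
apply: ge0_integralZl_EFin.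
- exact: measurableT.
- by move=> y _; rewrite lee_fin.
- exact/measurable_EFinP.
- exact: exprn_ge0 (mulr_ge0 (ler0n _ 2) c0).
Qed.

End cube_average.

(** * L^p estimates for differences of mollifications *)

Section Lp_estimates.
Variable p : R.
Hypothesis p1 : 1 < p.
Hypothesis n0 : (0 < n)%N.

Let p0 : 0 < p. Proof. exact: lt_trans p1. Qed.

Lemma powR_cube_le u x k : u \in Lfun mu p%:E ->
  (\int[mu]_(y in cube x (2 * 2 ^- k)) `|u y|) `^ p <=
  (4 ^+ n) `^ (p - 1) * (2 ^+ k) `^ (- (n%:R * (p - 1))) *
  \int[mu]_(y in cube x (2 * 2 ^- k)) `|u y| `^ p.
Proof.
move=> up; have k0 := exp2_gt0 k.
have kp : 0 < 2 ^- k :> R by rewrite invr_gt0.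
apply: (le_trans (Rintegral_powR_le p1 up (measurable_cube _ _) (lebesgue_cube_lty _ _))).
have mE : mu (cube x (2 * 2 ^- k)) = ((2 * (2 * 2 ^- k)) ^+ n)%:E.
  by rewrite lebesgue_cube// mulr_ge0// ltW.
rewrite [X in fine X]mE /=.
rewrite (_ : 2 * (2 * 2 ^- k) = 4 * 2 ^- k); last by field; rewrite gt_eqF.
rewrite exprMn powRM ?exprn_ge0// ?(ltW kp)//.
rewrite (_ : (2 ^- k) ^+ n = (2 ^+ k) `^ (- n%:R)); last first.
  by rewrite powR_invn ?(ltW k0)// exprVn.
by rewrite -powRrM mulNr.
Qed.

(** The exponent n - p is (n - 1) p, from the kernels in [mol_diff], minus n (p - 1), from the
    volume of the cube in Jensen's inequality. [Gam] is the sum of the |G i|, so that a single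
    function carries the bound. *)
Lemma mol_diff_powR u (G : 'I_n -> 'rV[R]_n -> R) :
  u \in Lfun mu p%:E -> (forall i, G i \in Lfun mu p%:E) ->
  (forall i, weak_partial_real i u (G i)) ->
  exists Gam : 'rV[R]_n -> R, exists C : R, [/\ Gam \in Lfun mu p%:E, 0 <= C &
   forall k l x x', (k <= l <= k.+1)%N ->
    (forall i, `|x' ord0 i - x ord0 i| <= 2 ^- k) ->
    `|mol u l x' - mol u k x| `^ p <=
    C * (2 ^+ k) `^ (n%:R - p) * \int[mu]_(y in cube x (2 * 2 ^- k)) `|Gam y| `^ p].
Proof.
move=> up Gp wG.
have lu := Lfun_locally_integrable (ltW p1) up.
have lG i := Lfun_locally_integrable (ltW p1) (Gp i).
have p1e : (1 <= p%:E)%E by rewrite lee_fin ltW.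
pose Gam := \sum_(i < n) (fun y => `|G i y|).
have GamE y : Gam y = \sum_i `|G i y| by rewrite /Gam fct_sumE.
have GamL : Gam \in Lfun mu p%:E.
  have cl := @Lfun_addr_closed _ _ _ mu _ p1e.
  rewrite /Gam; elim/big_ind : _ => [|f g fL gL|i _]; first exact: cl.1.
    exact: cl.2.
  apply: Lfun_powR_integrable => //.
    by apply: measurableT_comp => //; exact: Lfun_measurable (Gp i).
  by under eq_fun do rewrite normr_id; exact: Lfun_integrable (ltW p1) (Gp i).
have lGam := Lfun_locally_integrable (ltW p1) GamL.
pose K := (2 * M) ^+ n * n%:R.
have M0 := moll_gt0 rhoP.
have K0 : 0 <= K by rewrite mulr_ge0// exprn_ge0// mulr_ge0// ltW.
exists Gam, (K `^ p * (4 ^+ n) `^ (p - 1)); split => //.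
  by rewrite mulr_ge0// powR_ge0.
move=> k l x x' kl xx'; have k0 := exp2_gt0 k.
have := mol_diff kl lu lG wG xx'.
set A := \int[mu]_(y in cube x (2 * 2 ^- k)) `|Gam y|.
have GA i : \int[mu]_(y in cube x (2 * 2 ^- k)) `|G i y| <= A.
  apply: le_Rintegral.
  - exact: measurable_cube.
  - exact: (integrable_norm ((lG i).2 _ _)).
  - exact: (integrable_norm (lGam.2 _ _)).
  - move=> y _; rewrite GamE [leRHS]ger0_norm ?sumr_ge0//.
    by rewrite (bigD1 i)//= lerDl sumr_ge0.
have A0 : 0 <= A by apply: Rintegral_ge0.
move=> h; have {}h : `|mol u l x' - mol u k x| <= K * (2 ^+ k) ^+ n.-1 * A.
  apply: (le_trans h); rewrite /K.
  rewrite mulrAC mulrAC -!mulrA ler_wpM2l ?exprn_ge0 ?mulr_ge0 ?(ltW M0)//.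
  rewrite mulrCA ler_wpM2l ?exprn_ge0 ?(ltW k0)//.
  apply: (le_trans (ler_sum _ (fun i _ => GA i))).
  by rewrite sumr_const card_ord mulr_natl.
have T0 : 0 <= (2 ^+ k) ^+ n.-1 :> R by rewrite exprn_ge0// ltW.
apply: (le_trans (ge0_ler_powR (ltW p0) _ _ h)); rewrite ?nnegrE//.
  exact: mulr_ge0 (mulr_ge0 K0 T0) A0.
rewrite (powRM _ (mulr_ge0 K0 T0) A0) (powRM _ K0 T0).
have := powR_cube_le x k GamL; rewrite -/A => hA.
apply: (le_trans (ler_wpM2l _ hA)); first by rewrite mulr_ge0 ?powR_ge0.
rewrite -(powR_mulrn n.-1 (ltW k0)) -powRrM.
set J := Rintegral _ _ _.
rewrite (_ : n%:R - p = n.-1%:R * p + - (n%:R * (p - 1))); last first.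
  by rewrite -{1 3}(prednK n0) -natr1; ring.
rewrite [X in _ <= _ * X * _]powRD; last by apply/implyP => _; rewrite gt_eqF.
by rewrite le_eqVlt; apply/orP; left; apply/eqP; ring.
Qed.

Lemma mol0_powR u : u \in Lfun mu p%:E -> exists2 C : R, 0 <= C &
  forall x, `|mol u 0 x| `^ p <= C * \int[mu]_(y in cube x (2 * 2 ^- 0)) `|u y| `^ p.
Proof.
move=> up; have lu := Lfun_locally_integrable (ltW p1) up.
have M0 := moll_gt0 rhoP.
pose K := (M * 2 ^+ 0) ^+ n; have K0 : 0 <= K by rewrite exprn_ge0// mulr_ge0// ltW.
exists (K `^ p * ((4 ^+ n) `^ (p - 1))); first by rewrite mulr_ge0 ?powR_ge0.
move=> x; have := mol_bound 0 x lu; rewrite -/K.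
set A := Rintegral _ _ _ => h.
have A0 : 0 <= A by apply: Rintegral_ge0.
apply: (le_trans (ge0_ler_powR (ltW p0) _ _ h)); rewrite ?nnegrE//.
  exact: mulr_ge0.
rewrite (powRM _ K0 A0) -mulrA ler_wpM2l ?powR_ge0//.
have := powR_cube_le x 0 up; rewrite -/A.
by rewrite [X in X `^ (- _)]expr0 powR1 mulr1.
Qed.

Section sobolev.
Variables (u : 'rV[R]_n -> R) (G : 'I_n -> 'rV[R]_n -> R).
Hypothesis up : u \in Lfun mu p%:E.
Hypothesis Gp : forall i, G i \in Lfun mu p%:E.
Hypothesis wG : forall i, weak_partial_real i u (G i).

Lemma Rintegral_cube_powR_le h x c : h \in Lfun mu p%:E ->
  0 <= \int[mu]_(y in cube x c) `|h y| `^ p <= \int[mu]_y `|h y| `^ p.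
Proof.
move=> hp; apply/andP; split; first by apply: Rintegral_ge0 => y _; exact: powR_ge0.
have hi := Lfun_integrable (ltW p1) hp.
have /integrableP[mh hoo] := hi.
apply: fine_le.
- apply: integrable_fin_num => //; first exact: measurable_cube.
  by apply: integrableS hi => //; exact: measurable_cube.
- exact: integrable_fin_num.
- by apply: ge0_subset_integral => //; exact: measurable_cube.
Qed.

(** Replacing the cube integral by the integral over the whole space makes the bound uniform in x;
    the p-th root turns the exponent n - p into n/p - 1. *)
Lemma mol_diff_sup : exists2 C : R, 0 <= C &
  forall k l x x', (k <= l <= k.+1)%N ->
    (forall i, `|x' ord0 i - x ord0 i| <= 2 ^- k) ->
    `|mol u l x' - mol u k x| <= C * (2 ^+ k) `^ (n%:R / p - 1).
Proof.
have [Gam [C [Gamp C0 H]]] := mol_diff_powR up Gp wG.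
pose I := \int[mu]_y `|Gam y| `^ p.
exists ((C * I) `^ p^-1); first exact: powR_ge0.
move=> k l x x' kl xx'; have := H k l x x' kl xx'.
have /andP[J0 JI] := Rintegral_cube_powR_le x (2 * 2 ^- k) Gamp.
have I0 : 0 <= I := le_trans J0 JI.
set D := `|mol u l x' - mol u k x|; move=> h.
have T0 := powR_ge0 (2 ^+ k) (n%:R - p) : 0 <= _.
have {}h : D `^ p <= C * I * (2 ^+ k) `^ (n%:R - p).
  by apply: (le_trans h); rewrite mulrAC ler_wpM2r// ler_wpM2l.
have pV0 : 0 <= p^-1 by rewrite invr_ge0 ltW.
have := ge0_ler_powR pV0 _ _ h; rewrite !nnegrE powR_ge0 => /(_ isT).
rewrite mulr_ge0 ?mulr_ge0// => /(_ isT).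
rewrite -powRrM mulfV ?gt_eqF// powRr1 ?normr_ge0//.
rewrite (powRM _ (mulr_ge0 C0 I0) T0) -powRrM.
by rewrite mulrBl mulfV ?gt_eqF.
Qed.

(* Bound |w|^(p (r - 1)) pointwise by the full integral of |Gam|^p and integrate
   the cube averages in the remaining factor |w|^p. *)
Lemma integral_powR_gain (w Gam : 'rV[R]_n -> R) (B c r : R) :
  1 <= r -> 0 <= B -> 0 <= c -> measurable_fun setT w -> Gam \in Lfun mu p%:E ->
  (forall x, `|w x| `^ p <= B * \int[mu]_(y in cube x c) `|Gam y| `^ p) ->
  (\int[mu]_x (`|w x| `^ (p * r))%:E <=
   (B `^ r * (\int[mu]_y `|Gam y| `^ p)%R `^ (r - 1) *
    ((2 * c) ^+ n * (\int[mu]_y `|Gam y| `^ p)%R))%:E)%E.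
Proof.
move=> r1 B0 c0 mw Gp' wB.
set I := (\int[mu]_y `|Gam y| `^ p)%R.
have r0 : 0 < r := lt_le_trans ltr01 r1.
have Gi := Lfun_integrable (ltW p1) Gp'.
have mG : measurable_fun setT (fun y => `|Gam y| `^ p).
  by have /measurable_int /measurable_EFinP := Gi.
have IE : (\int[mu]_y (`|Gam y| `^ p)%:E = I%:E)%E.
  by rewrite /I /Rintegral fineK//; exact: integrable_fin_num.
have JE x : (\int[mu]_(y in cube x c) (`|Gam y| `^ p)%:E =
    (\int[mu]_(y in cube x c) `|Gam y| `^ p)%:E)%E.
  rewrite /Rintegral fineK//; apply: integrable_fin_num; first exact: measurable_cube.
  by apply: integrableS Gi => //; exact: measurable_cube.
have K0 : 0 <= B `^ r * I `^ (r - 1) by rewrite mulr_ge0// powR_ge0.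
have G0 y : 0 <= `|Gam y| `^ p by exact: powR_ge0.
have mJ := measurable_cube_average c mG G0.
apply: (@le_trans _ _ (\int[mu]_x ((B `^ r * I `^ (r - 1))%:E *
    \int[mu]_(y in cube x c) (`|Gam y| `^ p)%:E))%E).
  apply: ge0_le_integral => //.
  - apply/measurable_EFinP; apply: (measurableT_comp (measurable_powR _)).
    exact: measurableT_comp.
  - by apply: emeasurable_funM.
  - move=> x _; rewrite JE -EFinM lee_fin powRrM.
    have /andP[J0 JI] := Rintegral_cube_powR_le x c Gp'.
    apply: (le_trans (ge0_ler_powR (ltW r0) _ _ (wB x))); rewrite ?nnegrE ?powR_ge0//.
      by rewrite mulr_ge0.
    rewrite powRM// -mulrA ler_wpM2l ?powR_ge0//.
    rewrite -(mulr_powRB1 J0 r0) mulrC; apply: (ler_wpM2r J0).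
    have I0 : 0 <= I := le_trans J0 JI.
    by apply: ge0_ler_powR; rewrite ?nnegrE ?subr_ge0.
rewrite ge0_integralZl_EFin//; last by move=> x _; rewrite JE lee_fin; exact: Rintegral_ge0.
by rewrite integral_cube_average// IE -!EFinM.
Qed.

(** For this r the number (n - p) r - n equals 1 - r p, which is negative for every p > 1. *)
Definition sobolev_ratio : R := 1 + n%:R^-1.

(** The sequence is the partial sum of its differences, whose L^(p r) norms decay geometrically;
    [geometric_domination] then yields a bound and the convergence together. *)
Lemma mol_domination : exists h : 'rV[R]_n -> R, h \in Lfun mu (p * sobolev_ratio)%:E /\
  {ae mu, forall x, (forall m, `|mol u m x| <= h x) /\ cvgn (fun m => mol u m x)}.
Proof.
set r := sobolev_ratio.
have nr0 : 0 < n%:R :> R by rewrite ltr0n.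
have r1 : 1 < r by rewrite /r /sobolev_ratio ltrDl invr_gt0.
have r0 : 0 < r := lt_trans ltr01 r1.
have mu_ := Lfun_measurable up.
have [C0 C00 H0] := mol0_powR up.
have [Gam [C [Gamp C_0 H]]] := mol_diff_powR up Gp wG.
pose v k x := if k is k'.+1 then mol u k'.+1 x - mol u k' x else mol u 0 x.
have sumv m x : \sum_(k < m.+1) v k x = mol u m x.
  elim: m => [|m IH]; first by rewrite big_ord1.
  by rewrite big_ord_recr/= IH addrC subrK.
have mv k : measurable_fun setT (v k).
  case: k => [|k]; first exact: measurable_mol.
  by apply: measurable_funB; exact: measurable_mol.
(* The exponent is (n - p) r - n: the first term is the r-th power of the factor in [mol_diff_powR],
   the second comes from the volume of the cubes of side 4 * 2^-k. *)
pose theta : R := 2 `^ (1 - r * p).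
have th0 : 0 < theta by exact: powR_gt0.
have rp1 : 1 < r * p by rewrite -[ltLHS]mulr1 ltr_pM.
have th1 : theta < 1.
  have : 1 `^ (r * p - 1) < 2 `^ (r * p - 1) :> R.
    by apply: gt0_ltr_powR; rewrite ?nnegrE ?subr_gt0// ltr1n.
  by rewrite powR1 -[X in 2 `^ X]opprB powRN -/theta invf_gt1.
pose I1 := \int[mu]_y `|u y| `^ p; pose I2 := \int[mu]_y `|Gam y| `^ p.
pose A0 := C0 `^ r * I1 `^ (r - 1) * ((2 * (2 * 2 ^- 0)) ^+ n * I1).
pose A1 := C `^ r * I2 `^ (r - 1) * (4 ^+ n * I2).
have I10 : 0 <= I1 by apply: Rintegral_ge0 => y _; exact: powR_ge0.
have I20 : 0 <= I2 by apply: Rintegral_ge0 => y _; exact: powR_ge0.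
have A00 : 0 <= A0.
  apply: mulr_ge0 (mulr_ge0 (powR_ge0 _ _) (powR_ge0 _ _)) (mulr_ge0 _ I10).
  by rewrite expr0 invr1 exprn_ge0.
have A10 : 0 <= A1.
  apply: mulr_ge0 (mulr_ge0 (powR_ge0 _ _) (powR_ge0 _ _)) (mulr_ge0 _ I20).
  by rewrite exprn_ge0.
have A1th : 0 <= A1 / theta by exact: divr_ge0 A10 (ltW th0).
have vb0 : (\int[mu]_x (`|v 0%N x| `^ (p * r))%:E <= A0%:E)%E.
  apply: (integral_powR_gain (ltW r1) C00 _ (mv 0%N) up H0).
  by rewrite mulr_ge0// invr_ge0.
have vbS k : (\int[mu]_x (`|v k.+1 x| `^ (p * r))%:E <= (A1 * theta ^+ k)%:E)%E.
  have k0 := exp2_gt0 k.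
  have kp : 0 < 2 ^- k :> R by rewrite invr_gt0.
  have Hk x : `|v k.+1 x| `^ p <= C * (2 ^+ k) `^ (n%:R - p) *
      \int[mu]_(y in cube x (2 * 2 ^- k)) `|Gam y| `^ p.
    apply: H; first by rewrite leqnn leqnSn.
    by move=> i; rewrite subrr normr0 ltW.
  have ck0 : 0 <= 2 * 2 ^- k :> R by rewrite mulr_ge0// ltW.
  have Bk0 : 0 <= C * (2 ^+ k) `^ (n%:R - p) by rewrite mulr_ge0// powR_ge0.
  apply: (le_trans (integral_powR_gain (ltW r1) Bk0 ck0 (mv k.+1) Gamp Hk)).
  rewrite lee_fin -/I2 le_eqVlt; apply/orP; left; apply/eqP.
  rewrite powRM ?powR_ge0// -powRrM.
  rewrite (_ : 2 * (2 * 2 ^- k) = 4 * 2 ^- k); last by field; rewrite gt_eqF.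
  rewrite exprMn (_ : (2 ^- k) ^+ n = (2 ^+ k) `^ (- n%:R)); last first.
    by rewrite powR_invn ?(ltW k0)// exprVn.
  have -> : theta ^+ k = (2 ^+ k) `^ ((n%:R - p) * r) * (2 ^+ k) `^ (- n%:R).
    rewrite -powRD; last by apply/implyP => _; rewrite gt_eqF.
    have -> : 2 ^+ k = 2 `^ k%:R :> R by rewrite powR_mulrn.
    have -> : theta ^+ k = 2 `^ ((1 - r * p) * k%:R).
      by rewrite powRrM (powR_mulrn _ (ltW th0)).
    rewrite -[RHS]powRrM; congr (2 `^ _); rewrite /r /sobolev_ratio; field.
    by rewrite gt_eqF.
  by rewrite /A1; ring.
(* Dividing [A1] by theta makes up for the shift in [vbS], where [v k.+1] is bounded with
   theta^k. *)
have A : forall k, (\int[mu]_x (`|v k x| `^ (p * r))%:E <= ((A0 + A1 / theta) * theta ^+ k)%:E)%E.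
  move=> [|k]; [apply: (le_trans vb0)|apply: (le_trans (vbS k))]; rewrite lee_fin.
    by rewrite expr0 mulr1 lerDl.
  rewrite exprS mulrA ler_wpM2r ?exprn_ge0 ?(ltW th0)// mulrDl divfK ?gt_eqF//.
  by rewrite lerDr; exact: mulr_ge0 A00 (ltW th0).
have pr0 : 0 < p * r by rewrite mulr_gt0.
have AA : 0 <= A0 + A1 / theta := addr_ge0 A00 A1th.
have th01 : 0 < theta < 1 by rewrite th0.
have [h [hL hae]] := geometric_domination pr0 AA th01 mv A.
exists h; split=> //; apply: filterS hae => x [hx cx]; split.
  by move=> m; rewrite -sumv.
have -> : (fun m => mol u m x) = (fun m => \sum_(k < m.+1) v k x).
  by apply/funext => m; rewrite sumv.
move: cx => /cvg_ex[l vl]; apply/cvg_ex; exists l.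
by rewrite (cvg_shiftS (fun m => \sum_(k < m) v k x)).
Qed.

End sobolev.
End Lp_estimates.

Local Notation mu1 := (@lebesgue_measure R).

(** The variable of integration is the centre s, in which the kernel has the primitive -P(2^k (t -
    s)); this reflection explains the order of [b] and [a] in [dker]. *)
Lemma integral_ker_itv k (a b t : R) : a <= b ->
  mu1.-integrable setT (EFin \o (fun s => \1_(`]a, b]%classic : set R) s * ker k s t)) /\
  \int[mu1]_s (\1_(`]a, b]%classic : set R) s * ker k s t) = dker k k b a t.
Proof.
move=> ab.
have ck : continuous (fun s => ker k s t).
  have := smooth_continuous (smooth_affine (2 ^+ k) (- 2 ^+ k) t (moll_smooth rhoP)).
  by rewrite /ker; under [X in continuous X -> _]eq_fun do rewrite mulNr -mulrN opprB.
have mk : measurable_fun setT (fun s => ker k s t) by exact: continuous_measurable_fun.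
have mI : measurable (`]a, b]%classic : set (measurableTypeR R)) by exact: measurable_itv.
have ik : mu1.-integrable `]a, b]%classic (EFin \o (fun s => ker k s t)).
  apply: measurable_bounded_integrable => //.
  - by rewrite /= lebesgue_measure_itv; case: ifP => _; rewrite ?ltry// -EFinD ltry.
  - exact: measurable_funTS.
  - exists (M * 2 ^+ k); split; first exact: num_real.
    by move=> r rM s _; apply: le_trans (ker_bound _ _ _) (ltW rM).
have [i1 E1] := integral_indic_mul mI ik; split; first exact: i1.
rewrite [LHS]E1 Rintegral_itv_obnd_cbnd//.
have dP s : is_derive s (1 : R) (fun r => (- 1) * P (- 2 ^+ k * (r - t))) (ker k s t).
  have := is_derive_affine (- 1) (moll_derive rhoP (- 2 ^+ k * (s - t))).
  by rewrite mulN1r opprK mulNr -mulrN opprB.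
rewrite (integral_itv_derive ab ck dP) /dker !mulN1r !mulNr -!mulrN !opprB opprK addrC.
by [].
Qed.

(** * Integrals of mollifications over boxes *)

Section obox_average.
Variables (u : 'rV[R]_n -> R) (a b : 'I_n -> R).
Hypothesis lu : locally_integrable_rV u.
Hypothesis ab : forall i, a i <= b i.

Let c : R := \sum_i (`|a i| + `|b i|).

Let boxw k (i : 'I_n) : R -> R := dker k k (b i) (a i).

Let boxw_support k i s : boxw k i s != 0 -> a i < s < b i + 2 ^- k.
Proof.
have k0 := exp2_gt0 k; have abi := ab i; have kp : 0 < 2 ^- k :> R by rewrite invr_gt0.
apply: contra_neqT; rewrite negb_and -!leNgt /boxw /dker => /orP[h|h].
  rewrite (moll_le0 rhoP _).2; last by rewrite pmulr_rle0//; lra.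
  by rewrite (moll_le0 rhoP _).2 ?subrr// pmulr_rle0//; lra.
rewrite (moll_ge1 rhoP _).2; last by rewrite -ler_pdivrMl// mulr1; lra.
by rewrite (moll_ge1 rhoP _).2 ?subrr// -ler_pdivrMl// mulr1; lra.
Qed.

Let ab_c i : - c <= a i /\ b i <= c.
Proof.
rewrite /c (bigD1 i)//=.
have s0 : 0 <= \sum_(j | j != i) (`|a j| + `|b j|) by rewrite sumr_ge0// => j _; rewrite addr_ge0.
have := ler_norm (b i); have := ler_norm (- a i); rewrite normrN => a1 b1.
by have := normr_ge0 (a i); have := normr_ge0 (b i); lra.
Qed.

Let boxw_cube k i s : boxw k i s != 0 -> `|s - (0 : 'rV[R]_n) ord0 i| <= c + 1.
Proof.
move=> /boxw_support /andP[h1 h2]; have [h3 h4] := ab_c i.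
have : 2 ^- k <= 1 :> R by rewrite invf_le1 ?exp2_gt0// exprn_ege1// ler1n.
by rewrite mxE subr0 ler_norml => ?; apply/andP; split; lra.
Qed.

Let measurable_boxw k i : measurable_fun setT (boxw k i).
Proof.
apply: smooth_measurable; apply: smooth_primitive (is_derive_dker _ _ _ _) _.
by apply: smoothB; exact: smooth_ker.
Qed.

(** Fubini moves the integration over the box onto the kernel, where it splits into the
    one-dimensional integrals of [integral_ker_itv]. *)
Lemma mol_obox k : \int[mu]_(x in obox a b) mol u k x =
  \int[mu]_y (u y * prodf (fun i => dker k k (b i) (a i)) y).
Proof.
have k0 := exp2_gt0 k; have kp : 0 < 2 ^- k :> R by rewrite invr_gt0.
have M0 := moll_gt0 rhoP.
have [mu_ iu] := lu.
(* A kernel centred in the box reaches at most 2^-k <= 1 beyond it, so integrability is decided on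
   this enlarged cube. *)
pose Q := cube (0 : 'rV[R]_n) (c + 1).
pose C := (M * 2 ^+ k) ^+ n.
pose F (z : 'rV[R]_n * 'rV[R]_n) : R :=
  \1_(obox a b) z.1 * (u z.2 * prodf (fun i => ker k (z.1 ord0 i)) z.2).
have mB := measurable_obox a b.
have mQ : measurable Q by exact: measurable_cube.
have mF : measurable_fun setT F.
  apply: measurable_funM; last exact: joint_measurable_mol.
  have mI : measurable_fun setT (\1_(obox a b) : 'rV[R]_n -> R) by exact: measurable_indic.
  exact: (measurableT_comp mI measurable_fst).
have iF : (mu \x mu)%E.-integrable setT (EFin \o F).
  have Boo : (mu (obox a b) < +oo)%E.
    apply: le_lt_trans (lebesgue_cube_lty (0 : 'rV[R]_n) c).
    apply: le_measure; rewrite ?inE//; first exact: measurable_cube.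
    exact: obox_sub_cube.
  have [i1 _] := integral_indic_mul mB (integrable_cst_on C mB Boo).
  have [i2 _] := integral_indic_mul mQ (integrable_norm (iu 0 (c + 1))).
  apply: le_integrable (integrable_mul_prod i1 i2) => //.
    exact/measurable_EFinP.
  move=> [x y] _ /=; rewrite lee_fin.
  have C0 : 0 <= C by rewrite exprn_ge0// mulr_ge0// ltW.
  rewrite [leRHS]ger0_norm ?mulr_ge0//.
  rewrite /F/= !normrM; rewrite [\1_(obox a b) x]indicE.
  have [xB|xB] := boolP (x \in obox a b); last by rewrite normr0 !mul0r.
  rewrite normr1 !mul1r mulrC.
  have pb : `|prodf (fun i => ker k (x ord0 i)) y| <= C.
    by apply: prodf_bound => i; exact: ker_bound.
  rewrite indicE; have [yQ|yQ] := boolP (y \in Q).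
    by rewrite mul1r ler_wpM2r.
  rewrite (@prodf_cube0 _ _ _ (0 : 'rV[R]_n) (c + 1)) ?normr0 ?mul0r ?mulr0//.
    move=> i s /ker_support /andP[h1 h2]; have [h3 h4] := ab_c i.
    move: xB; rewrite inE => /(_ i) /andP[h5 h6].
    have : 2 ^- k <= 1 :> R by rewrite invf_le1 ?exp2_gt0// exprn_ege1// ler1n.
    by rewrite mxE subr0 ler_norml => ?; apply/andP; split; lra.
  by move: yQ; rewrite notin_setE.
have im x : mu.-integrable setT (EFin \o (fun y => u y * prodf (fun i => ker k (x ord0 i)) y)).
  apply: (@Rintegral_prodf_bound _ _ _ (fun i => ker k (x ord0 i)) x (2 ^- k) C lu _ _ _).1.
  - by move=> i; apply: smooth_measurable; exact: smooth_ker.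
  - by move=> i s /ker_support /andP[h1 h2]; rewrite ler_distl; apply/andP; split; lra.
  - by move=> y; apply: prodf_bound => i; exact: ker_bound.
rewrite /Rintegral; congr fine.
transitivity (\int[mu]_x \int[mu]_y (EFin \o F) (x, y))%E.
  rewrite integral_mkcond; apply: eq_integral => x _.
  rewrite patchE /F/= indicE; case: ifPn => xB.
    rewrite /mol /Rintegral fineK; last exact: (integrable_fin_num measurableT (im x)).
    by apply: eq_integral => y _; rewrite mul1r.
  by rewrite integral0_eq// => y _; rewrite mul0r.
rewrite (Fubini iF); apply: eq_integral => y _.
pose f i s := \1_(`]a i, b i]%classic : set R) s * ker k s (y ord0 i).
have iE i := integral_ker_itv k (y ord0 i) (ab i).
have [if_ Ef] := integral_prodf (fun i => (iE i).1).
have Ei x : (EFin \o F) (x, y) = ((u y)%:E * (prodf f x)%:E)%E.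
  rewrite /F/= -EFinM mulrCA; congr (_ * _)%:E.
  transitivity ((\prod_i \1_(`]a i, b i]%classic : set R) (x ord0 i)) *
      \prod_i ker k (x ord0 i) (y ord0 i)); last by rewrite -big_split.
  congr (_ * _).
  rewrite indicE; have [xB|xB] := boolP (x \in obox a b).
    rewrite big1// => i _; rewrite indicE mem_set//= in_itv/=.
    by move: xB; rewrite inE => /(_ i).
  apply/esym/eqP/prodf_eq0; move: xB; rewrite notin_setE => /existsNP[i xi].
  by exists i => //; rewrite indicE memNset//= in_itv/=.
under eq_integral do rewrite Ei.
rewrite (integralZl measurableT if_).
have -> : (\int[mu]_x (prodf f x)%:E = (\int[mu]_x prodf f x)%:E)%E.
  by rewrite /Rintegral fineK//; exact: integrable_fin_num.
rewrite -EFinM Ef; congr (_ * _)%:E.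
by apply: eq_bigr => i _; exact: (iE i).2.
Qed.

(** At a fixed point each factor is 0 or 1 for all large k. *)
Let prodf_boxw_cvg y : prodf (boxw k) y @[k --> \oo] --> (\1_(obox a b) y : R).
Proof.
have -> : \1_(obox a b) y = \prod_i ((a i < y ord0 i <= b i)%R%:R : R).
  rewrite indicE; have [yB|yB] := boolP (y \in obox a b).
    by rewrite big1// => i _; move: yB; rewrite inE => /(_ i) ->.
  apply/esym/eqP/prodf_eq0; move: yB; rewrite notin_setE => /existsNP[i /negP yi].
  by exists i => //; rewrite (negbTE yi).
rewrite /prodf.
(* Convergence as a binary relation between sequence and limit, the shape needed for an induction
   over two products. *)
pose K (F : nat -> R) (l : R) := F k @[k --> \oo] --> l.
suff : K (fun k => \prod_i boxw k i (y ord0 i)) (\prod_i ((a i < y ord0 i <= b i)%R%:R)) by [].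
have -> : (fun k => \prod_i boxw k i (y ord0 i)) = \prod_i (fun k => boxw k i (y ord0 i)).
  by apply/funext => k; rewrite fct_prodE.
elim/big_ind2 : _ => [|F1 l1 F2 l2 h1 h2|i _].
- exact: cvg_cst.
- exact: cvgM.
have abi := ab i; set t := y ord0 i.
have inf0 (e : R) : 0 < e -> \forall k \near \oo, 2 ^- k <= e.
  move=> e0; have : (geometric 1 (2^-1 : R)) @ \oo --> (0 : R).
    by apply: cvg_geometric; rewrite ger0_norm ?invr_ge0// invf_lt1// ltr1n.
  move/cvgr0Pnorm_le => /(_ e e0); apply: filterS => k /=.
  by rewrite mul1r exprVn ger0_norm ?invr_ge0 ?exprn_ge0.
rewrite /K; apply: cvg_near_cst.
have [ta|ta] := leP t (a i).
  apply: nearW => k; have k0 := exp2_gt0 k; rewrite /boxw /dker.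
  rewrite (moll_le0 rhoP _).2; last by rewrite pmulr_rle0//; lra.
  by rewrite (moll_le0 rhoP _).2 ?subrr// pmulr_rle0//; lra.
have [tb|tb] := leP t (b i).
  near=> k; have k0 := exp2_gt0 k; rewrite /boxw /dker /=.
  have : 2 ^- k <= t - a i by near: k; apply: inf0; lra.
  move=> h; rewrite (moll_ge1 rhoP _).2; last by rewrite -ler_pdivrMl// mulr1; lra.
  by rewrite (moll_le0 rhoP _).2 ?subr0// pmulr_rle0//; lra.
near=> k; have k0 := exp2_gt0 k; rewrite /boxw /dker /=.
have : 2 ^- k <= t - b i by near: k; apply: inf0; lra.
move=> h; rewrite (moll_ge1 rhoP _).2; last by rewrite -ler_pdivrMl// mulr1; lra.
by rewrite (moll_ge1 rhoP _).2 ?subrr// -ler_pdivrMl// mulr1; lra.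
Unshelve. all: by end_near. Qed.

Lemma mol_obox_cvg :
  (\int[mu]_(x in obox a b) mol u k x) @[k --> \oo] --> \int[mu]_(x in obox a b) u x.
Proof.
have [mu_ iu] := lu.
have M0 := moll_gt0 rhoP.
have mB := measurable_obox a b.
pose Q := cube (0 : 'rV[R]_n) (c + 1).
have mQ : measurable Q by exact: measurable_cube.
pose g y : \bar R := ((2 * M) ^+ n * (\1_Q y * `|u y|))%:E.
have ig : mu.-integrable setT g.
  have [i1 _] := integral_indic_mul mQ (integrable_norm (iu 0 (c + 1))).
  exact: (integrableZl measurableT ((2 * M) ^+ n) i1).
pose f k y : \bar R := (u y * prodf (boxw k) y)%:E.
pose f0 y : \bar R := (u y * \1_(obox a b) y)%:E.
have mf k : measurable_fun setT (f k).
  by apply/measurable_EFinP/measurable_funM => //; apply: measurable_prodf.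
have mf0 : measurable_fun setT f0.
  by apply/measurable_EFinP/measurable_funM => //; exact: measurable_indic.
have ff : {ae mu, forall x, setT x -> f ^~ x @ \oo --> f0 x}.
  apply/nearW => y _; apply: cvg_EFin; first exact: nearW.
  by apply: cvgM; [exact: cvg_cst|exact: prodf_boxw_cvg].
have fg : {ae mu, forall x k, setT x -> (`|f k x| <= g x)%E}.
  apply/nearW => y k _; rewrite /f /g /= lee_fin normrM mulrA [leRHS]mulrC.
  apply: ler_wpM2l => //; rewrite indicE; have [yQ|yQ] := boolP (y \in Q).
    by rewrite mulr1; apply: prodf_bound => i; exact: dker_bound.
  rewrite (@prodf_cube0 _ _ _ (0 : 'rV[R]_n) (c + 1)) ?normr0 ?mulr0//.
    by move=> i s; exact: boxw_cube.
  by move: yQ; rewrite notin_setE.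
have [if0 _ H] := dominated_convergence measurableT mf mf0 ff ig fg.
have -> : \int[mu]_(x in obox a b) u x = fine (\int[mu]_x f0 x)%E.
  rewrite Rintegral_mkcond /Rintegral; congr fine; apply: eq_integral => y _.
  by rewrite /f0 patchE indicE; case: ifPn => _; rewrite ?mulr1 ?mulr0.
under eq_fun do rewrite mol_obox.
apply: fine_cvg; rewrite fineK; last exact: integrable_fin_num.
exact: H.
Qed.

End obox_average.

(** By dominated convergence the pointwise limit has the same integral as [u] over every box, hence
    agrees with it almost everywhere; this stands in for Lebesgue's differentiation theorem. *)
Lemma mol_cvg_ae u h (q : R) : 1 <= q -> locally_integrable_rV u ->
  h \in Lfun mu q%:E ->
  {ae mu, forall x, (forall m, `|mol u m x| <= h x) /\ cvgn (fun m => mol u m x)} ->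
  {ae mu, forall x, mol u m x @[m --> \oo] --> u x}.
Proof.
move=> q1 lu hq hae; have [mu_ iu] := lu.
have [mh ih] := Lfun_locally_integrable q1 hq.
(* The upper limit is measurable on the whole space and coincides with the limit wherever there is
   one. *)
pose g x : R := fine (limn_esup (fun m => (mol u m x)%:E)).
have mm m : measurable_fun setT (EFin \o mol u m).
  by apply/measurable_EFinP; exact: measurable_mol.
have mg : measurable_fun setT g.
  apply: (measurableT_comp (fine_measurable measurableT)).
  exact: (measurable_fun_limn_esup mm).
have gE x : cvgn (fun m => mol u m x) -> mol u m x @[m --> \oo] --> g x.
  move=> /cvg_ex[l ml]; suff -> : g x = l by [].
  have /cvg_limn_einf_sup[_ H] : (mol u m x)%:E @[m --> \oo] --> l%:E.
    by apply: cvg_EFin => //; exact: nearW.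
  by rewrite /g H.
have gh : {ae mu, forall x, `|g x| <= h x}.
  apply: filterS hae => x [mhx cx].
  have gx := gE x cx.
  have ngx : `|mol u m x| @[m --> \oo] --> `|g x| by exact: cvg_norm.
  have <- := cvg_lim (@Rhausdorff R) ngx.
  apply: limr_le; first by apply/cvg_ex; exists `|g x|.
  exact: nearW.
have ig x c : mu.-integrable (cube x c) (EFin \o g).
  have mc := measurable_cube x c.
  have /integrableP[_ hoo] := ih x c.
  apply/integrableP; split; first by apply/measurable_EFinP; exact: measurable_funTS.
  apply: le_lt_trans hoo; apply: ae_ge0_le_integral => //.
  - by do 2 apply: measurableT_comp => //; exact: measurable_funTS.
  - by do 2 apply: measurableT_comp => //; exact: measurable_funTS.
  - apply: filterS gh => y gy _ /=; rewrite lee_fin.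
    by apply: le_trans gy _; exact: ler_norm.
have iwb w a b : locally_integrable_rV w -> mu.-integrable (obox a b) (EFin \o w).
  move=> [_ iw]; apply: integrableS (iw 0 (\sum_i (`|a i| + `|b i|))).
  - exact: measurable_cube.
  - exact: measurable_obox.
  - exact: obox_sub_cube.
have : {ae mu, forall x, u x - g x = 0}.
  apply: ae_eq0_obox.
  - exact: measurable_funB.
  - move=> x c; have mc := measurable_cube x c.
    exact: (integrableB mc (iu x c) (ig x c)).
  - move=> a b ab; have mB := measurable_obox a b.
    rewrite RintegralB//; [|exact: iwb|exact: iwb].
    apply/eqP; rewrite subr_eq0; apply/eqP.
    apply: (@cvg_unique _ (@Rhausdorff R) _ _ _ _ (mol_obox_cvg lu ab)).
    have m1 m : measurable_fun (obox a b) (EFin \o mol u m) by exact: measurable_funTS.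
    have mg1 : measurable_fun (obox a b) (EFin \o g).
      by apply/measurable_EFinP; exact: measurable_funTS.
    have c1 : {ae mu, forall x, obox a b x -> (EFin \o mol u m) x @[m --> \oo] --> (EFin \o g) x}.
      apply: filterS hae => x [_ /gE cx] _ /=.
      by apply: cvg_EFin => //; exact: nearW.
    have d1 : {ae mu, forall x m, obox a b x -> (`|(EFin \o mol u m) x| <= (EFin \o h) x)%E}.
      by apply: filterS hae => x [mhx _] m _; rewrite /= lee_fin.
    have [_ _ H] := dominated_convergence mB m1 mg1 c1 (iwb h a b (conj mh ih)) d1.
    apply: fine_cvg; rewrite fineK; last first.
      by apply: integrable_fin_num => //; exact: iwb.
    exact: H.
by apply: filterS2 hae => x [_ /gE cx] /eqP; rewrite subr_eq0 => /eqP ->.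
Qed.

End mollification.

(** * Gain of integrability from a weak gradient *)

Section sobolev_embedding.
Context {R : realType} (n : nat).
Local Notation mu := (@lebesgue_rV R n).
Variables (p : R) (u : 'rV[R]_n -> R) (G : 'I_n -> 'rV[R]_n -> R).
Hypotheses (p1 : 1 < p) (n0 : (0 < n)%N).
Hypothesis up : u \in Lfun mu p%:E.
Hypothesis Gp : forall i, G i \in Lfun mu p%:E.
Hypothesis wG : forall i, weak_partial_real i u (G i).

Let ratio_gt1 : 1 < sobolev_ratio n :> R.
Proof. by rewrite /sobolev_ratio ltrDl invr_gt0 ltr0n. Qed.

Lemma mol_cvg_ae_sobolev rho P M : is_mollifier rho P M ->
  {ae mu, forall x, mol rho u m x @[m --> \oo] --> u x}.
Proof.
move=> rhoP; have [h [hq hae]] := mol_domination rhoP p1 n0 up Gp wG.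
apply: (mol_cvg_ae rhoP _ (Lfun_locally_integrable (ltW p1) up) hq hae).
by rewrite -[leLHS]mulr1 ler_pM// ltW.
Qed.

(** [u] is the almost everywhere limit of mollifications that stay below a function of the better
    space. *)
Lemma sobolev_gain : u \in Lfun mu (p * sobolev_ratio n)%:E.
Proof.
have [rho [P [S [M [srho dP dS [lo hi M0 bnd rho0]]]]]] := @mollifier_exists R.
have rhoP : is_mollifier rho P M.
  split => // s; first by move=> /lo[].
  by move=> /hi[].
have cu := mol_cvg_ae_sobolev rhoP.
have [h [hq hae]] := mol_domination rhoP p1 n0 up Gp wG.
set q := p * _ in hq *.
have q1 : 1 <= q by rewrite -[leLHS]mulr1 ler_pM// ltW.
have uh : {ae mu, forall x, `|u x| <= h x}.
  apply: filterS2 cu hae => x cx [mhx _].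
  have ngx : `|mol rho u m x| @[m --> \oo] --> `|u x| by exact: cvg_norm.
  have <- := cvg_lim (@Rhausdorff R) ngx.
  apply: limr_le; first by apply/cvg_ex; exists `|u x|.
  exact: nearW.
apply: Lfun_ae_le q1 (Lfun_measurable up) hq _.
by apply: filterS uh => x ux; apply: le_trans ux (ler_norm _).
Qed.

End sobolev_embedding.

(** * Morrey's inequality: bounded Hoelder representatives *)

Section morrey.
Context {R : realType} (n : nat) (rho P : R -> R) (M : R).
Local Notation mu := (@lebesgue_rV R n).
Local Notation mu1 := (@lebesgue_measure R).
Hypothesis rhoP : is_mollifier rho P M.
Variables (p gamma : R).
Hypotheses (p1 : 1 < p) (n0 : (0 < n)%N) (g0 : 0 < gamma).
Hypothesis pg : n%:R / p <= 1 - gamma.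
Local Notation mol := (mol (n := n) rho).

(** Distance enters through any common bound [D] on the coordinate differences, which is how
    [mol_diff] measures displacement. *)
Definition coord_holder (C : R) (v : 'rV[R]_n -> R) : Prop :=
  forall (x x' : 'rV[R]_n) (D : R), (forall i, `|x' ord0 i - x ord0 i| <= D) ->
    `|v x' - v x| <= C * D `^ gamma.

Let p0 : 0 < p. Proof. exact: lt_trans p1. Qed.

Let theta : R := 2 `^ (- gamma).

Let theta_gt0 : 0 < theta. Proof. exact: powR_gt0. Qed.

Let theta_lt1 : theta < 1.
Proof.
have : 1 `^ gamma < 2 `^ gamma :> R.
  by apply: gt0_ltr_powR; rewrite ?nnegrE// ltr1n.
by rewrite powR1 /theta powRN invf_lt1// powR_gt0.
Qed.

Let thetaE k : theta ^+ k = (2 ^- k) `^ gamma.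
Proof.
have -> : 2 ^- k = 2 `^ (- k%:R) :> R by rewrite powR_invn.
by rewrite -[RHS]powRrM mulNr -(powR_mulrn k (ltW theta_gt0)) -[LHS]powRrM mulNr mulrC.
Qed.

Section limit.
Variables (u : 'rV[R]_n -> R) (G : 'I_n -> 'rV[R]_n -> R).
Hypothesis up : u \in Lfun mu p%:E.
Hypothesis Gp : forall i, G i \in Lfun mu p%:E.
Hypothesis wG : forall i, weak_partial_real i u (G i).

Lemma mol_diff_holder : exists2 C : R, 0 <= C &
  forall k l (x x' : 'rV[R]_n), (k <= l <= k.+1)%N ->
    (forall i, `|x' ord0 i - x ord0 i| <= 2 ^- k) ->
    `|mol u l x' - mol u k x| <= C * theta ^+ k.
Proof.
have [C C0 H] := mol_diff_sup rhoP p1 n0 up Gp wG.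
exists C => // k l x x' kl xx'; apply: (le_trans (H k l x x' kl xx')).
rewrite ler_wpM2l// thetaE.
have k1 : 1 <= 2 ^+ k :> R by rewrite exprn_ege1// ler1n.
have -> : (2 ^- k) `^ gamma = (2 ^+ k) `^ (- gamma).
  by rewrite powRN -powR_inv1 ?exprn_ge0// -powRrM mulN1r powRN.
by apply: ler_powR => //; rewrite lerBlDr addrC.
Qed.

(** Points at distance at least 1 are handled by the sup bound; closer ones are compared through the
    mollification at the dyadic scale of their distance. *)
Lemma morrey_limit : exists v : 'rV[R]_n -> R, exists2 C : R, 0 <= C &
  [/\ forall x, mol u m x @[m --> \oo] --> v x,
      forall x, `|v x| <= C,
      coord_holder C v
    & {ae mu, forall x, u x = v x}].
Proof.
have [C C0 H] := mol_diff_holder.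
have th1 : 0 < 1 - theta by rewrite subr_gt0.
have step x k : `|mol u k.+1 x - mol u k x| <= C * theta ^+ k.
  apply: H; first by rewrite leqnSn leqnn.
  by move=> i; rewrite subrr normr0 invr_ge0 exprn_ge0.
have mdiff x k m : `|mol u (k + m) x - mol u k x| <= C * theta ^+ k * (1 - theta)^-1.
  apply: (@le_trans _ _ (series (geometric (C * theta ^+ k) theta) m)); last first.
    apply: geometric_le_lim => //; first by rewrite mulr_ge0// exprn_ge0// ltW.
    by rewrite gtr0_norm.
  elim: m => [|m IH]; first by rewrite addn0 subrr normr0 /series/= big_geq.
  rewrite /series/= big_nat_recr//= -/(series _ m) addnS.
  rewrite -(subrK (mol u (k + m) x) (mol u (k + m).+1 x)) -addrA addrC.
  apply: (le_trans (ler_normD _ _)); rewrite lerD//.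
  by rewrite -mulrA -exprD; exact: step.
have cv x : cvgn (fun m => mol u m x).
  pose v k := mol u k.+1 x - mol u k x.
  have cs : cvgn (series v).
    apply: normed_cvg.
    apply: (@series_le_cvg _ _ (geometric C theta)) => //.
    - by move=> k /=.
    - by move=> k; rewrite /= mulr_ge0 ?exprn_ge0// ltW.
    - by move=> k; exact: step.
    - by apply: is_cvg_geometric_series; rewrite gtr0_norm.
  have -> : (fun m => mol u m x) = (fun m => series v m + mol u 0 x).
    by apply/funext => m; rewrite /series/= telescope_sumr// subrK.
  by apply: is_cvgD => //; exact: is_cvg_cst.
pose v x := limn (fun m => mol u m x).
have mv x : mol u m x @[m --> \oo] --> v x by exact: cv.
pose K := C * (1 - theta)^-1.
have K0 : 0 <= K by rewrite mulr_ge0// invr_ge0 ltW.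
have vk x k : `|v x - mol u k x| <= K * theta ^+ k.
  have cvd : `|mol u m x - mol u k x| @[m --> \oo] --> `|v x - mol u k x|.
    by apply: cvg_norm; apply: cvgB => //; exact: cvg_cst.
  rewrite -(cvg_lim (@Rhausdorff R) cvd); apply: limr_le; first by apply/cvg_ex; eexists; exact: cvd.
  exists k => // m /= km; rewrite -(subnKC km) /K mulrAC.
  exact: mdiff.
have [C1 C10 H1] := mol0_powR rhoP p1 up.
pose I := \int[mu]_y `|u y| `^ p.
have b0 x : `|mol u 0 x| <= (C1 * I) `^ p^-1.
  have /andP[J0 JI] := Rintegral_cube_powR_le p1 x (2 * 2 ^- 0) up.
  have h := le_trans (H1 x) (ler_wpM2l C10 JI).
  have pV0 : 0 <= p^-1 by rewrite invr_ge0 ltW.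
  have I0 : 0 <= I := le_trans J0 JI.
  have := ge0_ler_powR pV0 _ _ h; rewrite !nnegrE powR_ge0 (mulr_ge0 C10 I0) => /(_ isT isT).
  by rewrite -powRrM mulfV ?gt_eqF// powRr1.
have [B B0 vB] : exists2 B, 0 <= B & forall x, `|v x| <= B.
  exists ((C1 * I) `^ p^-1 + K) => [|x]; first by rewrite addr_ge0// powR_ge0.
  rewrite -(subrK (mol u 0 x) (v x)) addrC; apply: (le_trans (ler_normD _ _)).
  by rewrite lerD//; have := vk x 0%N; rewrite expr0 mulr1.
pose L := 2 * (K + K + C).
have KKC : 0 <= K + K + C := addr_ge0 (addr_ge0 K0 K0) C0.
have L0 : 0 <= L by rewrite mulr_ge0.
have BB : 0 <= B + B := addr_ge0 B0 B0.
have BBL : 0 <= B + B + L := addr_ge0 BB L0.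
exists v, (B + B + L); first exact: BBL.
split => //.
- by move=> x; rewrite (le_trans (vB x))// -addrA lerDl; exact: addr_ge0.
- move=> x x' D xD.
  have D0 : 0 <= D by apply: le_trans (xD (Ordinal n0)).
  have [D1|D1] := leP 1 D.
    have D1g : 1 <= D `^ gamma by rewrite -(powRr0 D) ler_powR// ltW.
    apply: (@le_trans _ _ (B + B)).
      by apply: (le_trans (ler_normB _ _)); rewrite lerD.
    by rewrite -[leLHS]mulr1; apply: ler_pM => //; rewrite lerDl.
  move: D0; rewrite le_eqVlt => /predU1P[D00|D0].
    have -> : x' = x.
      apply/rowP => i; apply/eqP; rewrite -subr_eq0 -normr_le0.
      by have := xD i; rewrite -D00.
    by rewrite subrr normr0; exact: mulr_ge0 BBL (powR_ge0 _ _).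
  have exk : exists k, 2 ^- k < D.
    have : (geometric 1 (2^-1 : R)) @ \oo --> (0 : R).
      by apply: cvg_geometric; rewrite ger0_norm ?invr_ge0// invf_lt1// ltr1n.
    move/cvgr0Pnorm_lt => /(_ D D0) [k _ /(_ k (leqnn k))] /=.
    rewrite mul1r exprVn ger0_norm ?invr_ge0 ?exprn_ge0// => ?.
    by exists k.
  (* The least index is not 0 because D < 1; its predecessor k satisfies 2^-(k+1) < D <= 2^-k. *)
  have [k kD kmin] := ex_minnP exk.
  case: k kD kmin => [|k] kD kmin; first by move: kD; rewrite expr0 invr1 ltNge (ltW D1).
  have Dk : D <= 2 ^- k.
    by rewrite leNgt; apply/negP => /kmin; rewrite ltnn.
  have thD : theta ^+ k <= 2 * D `^ gamma.
    have : (2 ^- k) `^ gamma <= (2 * D) `^ gamma.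
      apply: ge0_ler_powR; rewrite ?nnegrE ?invr_ge0 ?exprn_ge0 ?mulr_ge0// ?(ltW D0) ?(ltW g0)//.
      move: kD; rewrite exprS invfM => kD.
      by rewrite -ler_pdivrMl//; exact: ltW.
    rewrite thetaE => h; apply: (le_trans h); rewrite powRM ?(ltW D0)//.
    rewrite ler_wpM2r ?powR_ge0//.
    (* [pg] forces gamma <= 1, whence 2^gamma <= 2. *)
    rewrite -[leRHS]powRr1// ler_powR ?ler1n//.
    by rewrite -subr_ge0 (le_trans _ pg)// divr_ge0// ltW.
  have xk i : `|x' ord0 i - x ord0 i| <= 2 ^- k by exact: le_trans (xD i) Dk.
  have kk : (k <= k <= k.+1)%N by rewrite leqnn leqnSn.
  have Hk := H k k x x' kk xk.
  have v1 := vk x k; have v2 := vk x' k.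
  have : `|v x' - v x| <= (K + K + C) * theta ^+ k.
    rewrite (_ : v x' - v x = (v x' - mol u k x') - (v x - mol u k x) + (mol u k x' - mol u k x)); last by ring.
    apply: (le_trans (ler_normD _ _)); rewrite 2!mulrDl lerD//.
    by apply: (le_trans (ler_normB _ _)); rewrite lerD.
  move=> h; apply: (le_trans h).
  apply: (le_trans (ler_wpM2l KKC thD)).
  by rewrite mulrA [_ * 2]mulrC -/L ler_wpM2r ?powR_ge0// lerDr.
- apply: filterS (mol_cvg_ae_sobolev p1 n0 up Gp wG rhoP) => x ux.
  exact: (cvg_unique (@Rhausdorff R) ux (mv x)).
Qed.

End limit.

(** * Classical derivatives of the Hoelder representative *)

Variable S : R -> R.
Hypothesis dS : forall s, is_derive s (1 : R) S (P s).
Hypothesis S0 : forall s, s <= 0 -> S s = 0.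
Hypothesis S1 : forall s, 1 <= s -> S s = S 1 + (s - 1).

Lemma integral_compact_support (f F : R -> R) (a b : R) : a <= b -> continuous f ->
  (forall s, is_derive s (1 : R) F (f s)) -> (forall s, f s != 0 -> a <= s <= b) ->
  mu1.-integrable setT (EFin \o f) /\ \int[mu1]_s f s = F b - F a.
Proof.
move=> ab cf dF fab.
have mI : measurable (`[a, b]%classic : set (measurableTypeR R)) by exact: measurable_itv.
have fi : mu1.-integrable `[a, b]%classic (EFin \o f).
  apply: continuous_compact_integrable; first exact: segment_compact.
  exact: continuous_subspaceT.
have [i1 E1] := integral_indic_mul mI fi.
have E : (fun s => \1_(`[a, b]%classic : set (measurableTypeR R)) s * f s) = f.
  apply/funext => s; rewrite indicE; have [sab|sab] := boolP (s \in _); first by rewrite mul1r.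
  rewrite mul0r; apply/esym/eqP; apply: contraNT sab => /fab h.
  by rewrite inE/= in_itv.
by rewrite E in i1 E1; rewrite E1 (integral_itv_derive ab cf dF).
Qed.

Lemma moll_le s s' : s <= s' -> P s <= P s'.
Proof.
move=> ss'; have cP := is_derive_continuous (moll_derive rhoP).
have [c _] := MVT_segment ss' (fun s _ => moll_derive rhoP s) (continuous_subspaceT cP).
by move=> E; rewrite -subr_ge0 E mulr_ge0 ?subr_ge0//; exact: (moll_ge0 rhoP).
Qed.

Lemma integral_ker k s0 : mu1.-integrable setT (EFin \o ker rho k s0) /\
  \int[mu1]_s ker rho k s0 s = 1.
Proof.
have k0 := exp2_gt0 (R := R) k.
have kp : 0 < 2 ^- k :> R by rewrite invr_gt0.
have [||||i1 ->] := @integral_compact_support (ker rho k s0)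
  (fun s => P (2 ^+ k * (s - s0))) s0 (s0 + 2 ^- k).
- by rewrite lerDl ltW.
- exact: smooth_continuous (smooth_ker rhoP k s0).
- by move=> s; exact: (is_derive_P rhoP).
- by move=> s /(ker_support rhoP)/andP[h1 h2]; rewrite !ltW.
split => //; rewrite addrAC subrr add0r mulfV ?gt_eqF// mulr0.
by rewrite (moll_ge1 rhoP _).2// (moll_le0 rhoP _).2// subr0.
Qed.

(** [S] has slope 1 beyond 1, so its two rescaled copies, shifted by t against each other, end up
    differing by exactly t. *)
Lemma integral_dker k s0 t : 0 <= t ->
  mu1.-integrable setT (EFin \o dker P k k (s0 + t) s0) /\
  \int[mu1]_s dker P k k (s0 + t) s0 s = t.
Proof.
move=> t0; have k0 := exp2_gt0 (R := R) k.
have kp : 0 < 2 ^- k :> R by rewrite invr_gt0.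
pose F r s := 2 ^- k * S (2 ^+ k * (s - r)).
have dF r s : is_derive s (1 : R) (F r) (P (2 ^+ k * (s - r))).
  have := is_derive_affine (2 ^- k) (dS (2 ^+ k * (s - r))).
  by rewrite mulVf ?gt_eqF// mul1r.
have [|||i1 ->] := @integral_compact_support (dker P k k (s0 + t) s0)
  (fun s => F s0 s - F (s0 + t) s) s0 (s0 + t + 2 ^- k).
- by rewrite -addrA lerDl addr_ge0// ltW.
- exact: is_derive_continuous (is_derive_dker rhoP k k (s0 + t) s0).
- move=> s; apply: contra_neqT; rewrite negb_and -!ltNge /dker => /orP[h|h].
    rewrite (moll_le0 rhoP _).2; last by rewrite pmulr_rle0//; lra.
    by rewrite (moll_le0 rhoP _).2 ?subrr// pmulr_rle0//; lra.
  rewrite (moll_ge1 rhoP _).2; last by rewrite -ler_pdivrMl// mulr1; lra.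
  by rewrite (moll_ge1 rhoP _).2 ?subrr// -ler_pdivrMl// mulr1; lra.
split => //; rewrite /F.
rewrite (S0 (s := 2 ^+ k * (s0 - s0))); last by rewrite subrr mulr0.
rewrite (S0 (s := 2 ^+ k * (s0 - (s0 + t)))); last by rewrite pmulr_rle0//; lra.
rewrite (_ : 2 ^+ k * (s0 + t + 2 ^- k - s0) = 2 ^+ k * t + 1); last first.
  by field; rewrite gt_eqF.
rewrite (_ : 2 ^+ k * (s0 + t + 2 ^- k - (s0 + t)) = 1); last by field; rewrite gt_eqF.
rewrite S1; last by rewrite lerDr mulr_ge0// ltW.
by field; rewrite gt_eqF.
Qed.

Section derivative.
Variables (u : 'rV[R]_n -> R) (G : 'I_n -> 'rV[R]_n -> R).
Hypothesis up : u \in Lfun mu p%:E.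
Hypothesis Gp : forall i, G i \in Lfun mu p%:E.
Hypothesis wG : forall i, weak_partial_real i u (G i).
Variables (v g : 'rV[R]_n -> R) (i : 'I_n) (K : R).
Hypothesis K0 : 0 <= K.
Hypothesis mv : forall x, mol u m x @[m --> \oo] --> v x.
Hypothesis gK : coord_holder K g.
Hypothesis Gg : {ae mu, forall x, G i x = g x}.

(* A nonnegative kernel of integral [t], concentrated near the segment from [x]
   to its translate by [t] along the [i]-th axis. *)
Let bar k t (x : 'rV[R]_n) := updf (fun j => ker rho k (x ord0 j)) i (dker P k k (x ord0 i + t) (x ord0 i)).

Let bar_ge0 k t x y : 0 <= t -> 0 <= prodf (bar k t x) y.
Proof.
move=> t0; rewrite prodf_upd mulr_ge0//; last first.
  apply: prodr_ge0 => j _; rewrite mulr_ge0 ?(ltW (exp2_gt0 _))//.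
  exact: (moll_ge0 rhoP).
rewrite /dker subr_ge0; apply: moll_le.
by rewrite ler_wpM2l ?(ltW (exp2_gt0 _))//; lra.
Qed.

Let bar_support k t x : 0 <= t -> forall j s, bar k t x j s != 0 ->
  `|s - x ord0 j| <= t + 2 ^- k.
Proof.
move=> t0 j s; have kp : 0 < 2 ^- k :> R by rewrite invr_gt0 exp2_gt0.
rewrite /bar /updf; have [->|_] := eqVneq j i; last first.
  by move=> /(ker_support rhoP)/andP[h1 h2]; rewrite ler_distl; apply/andP; split; lra.
have k0 := exp2_gt0 (R := R) k.
apply: contra_neqT; rewrite -ltNge lter_normr /dker => /orP[h|h].
  rewrite (moll_ge1 rhoP _).2; last by rewrite -ler_pdivrMl// mulr1; lra.
  by rewrite (moll_ge1 rhoP _).2 ?subrr// -ler_pdivrMl// mulr1; lra.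
rewrite (moll_le0 rhoP _).2; last by rewrite pmulr_rle0//; lra.
by rewrite (moll_le0 rhoP _).2 ?subrr// pmulr_rle0//; lra.
Qed.

Let integral_bar k t x : 0 <= t ->
  mu.-integrable setT (EFin \o prodf (bar k t x)) /\ \int[mu]_y prodf (bar k t x) y = t.
Proof.
move=> t0.
have ib j : mu1.-integrable setT (EFin \o bar k t x j).
  rewrite /bar /updf; case: eqP => _; first exact: (integral_dker k (x ord0 i) t0).1.
  exact: (integral_ker k (x ord0 j)).1.
have [ip ->] := integral_prodf ib; split => //.
rewrite (bigD1 i)//= /bar {1}/updf eqxx (integral_dker k (x ord0 i) t0).2.
rewrite big1 ?mulr1// => j ji; rewrite /updf (negbTE ji).
exact: (integral_ker k (x ord0 j)).2.
Qed.

Let bar_bounded k t x : exists C : R, forall y, `|prodf (bar k t x) y| <= C.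
Proof.
have M0 := moll_gt0 rhoP.
exists ((2 * M + M * 2 ^+ k) ^+ n) => y; apply: prodf_bound => j.
rewrite /bar /updf; case: eqP => _.
  apply: (le_trans (dker_bound rhoP _ _ _ _ _)); rewrite lerDl mulr_ge0 ?exprn_ge0//; lra.
by apply: (le_trans (ker_bound rhoP _ _ _)); rewrite lerDr; lra.
Qed.

Let measurable_bar k t x j : measurable_fun setT (bar k t x j).
Proof.
apply: smooth_measurable; rewrite /bar /updf; case: eqP => _; last exact: (smooth_ker rhoP).
by apply: smooth_primitive (is_derive_dker rhoP _ _ _ _) _; apply: smoothB; exact: (smooth_ker rhoP).
Qed.

(** A translation along the i-th axis changes the i-th kernel alone, so every other term of the
    telescoping sum contains a zero factor. *)
Lemma mol_increment k t x : 0 <= t ->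
  mol u k (t *: delta_mx ord0 i + x) - mol u k x =
  \int[mu]_y (G i y * prodf (bar k t x) y).
Proof.
move=> t0; set x' := _ + x.
have kp : 0 < 2 ^- k :> R by rewrite invr_gt0 exp2_gt0.
have x'i : x' ord0 i = x ord0 i + t by rewrite !mxE !eqxx mulr1 addrC.
have x'j j : j != i -> x' ord0 j = x ord0 j.
  by move=> ji; rewrite !mxE eqxx (negbTE ji) mulr0 add0r.
have M0 := moll_gt0 rhoP.
have xt j : x ord0 j <= x' ord0 j <= x ord0 j + t.
  by have [->|ji] := eqVneq j i; [rewrite x'i|rewrite x'j//]; apply/andP; split; lra.
have sa j s : ker rho k (x ord0 j) s != 0 -> `|s - x ord0 j| <= t + 2 ^- k.
  by move=> /(ker_support rhoP)/andP[h1 h2]; rewrite ler_distl; apply/andP; split; lra.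
have sb j s : ker rho k (x' ord0 j) s != 0 -> `|s - x ord0 j| <= t + 2 ^- k.
  have /andP[h3 h4] := xt j.
  by move=> /(ker_support rhoP)/andP[h1 h2]; rewrite ler_distl; apply/andP; split; lra.
have sd j s : dker P k k (x' ord0 j) (x ord0 j) s != 0 -> `|s - x ord0 j| <= t + 2 ^- k.
  have [->|ji] := eqVneq j i.
    rewrite x'i => h; have := @bar_support k t x t0 i s.
    by rewrite /bar /updf eqxx; apply.
  by rewrite x'j// /dker subrr eqxx.
have := weak_partial_telescope (fun j => smooth_ker rhoP k (x ord0 j))
  (fun j => smooth_ker rhoP k (x' ord0 j))
  (fun j s => is_derive_dker rhoP k k (x' ord0 j) (x ord0 j) s) sa sb sd
  (fun j s => ker_bound rhoP k (x ord0 j) s) (fun j s => ker_bound rhoP k (x' ord0 j) s)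
  (Lfun_locally_integrable (ltW p1) up) wG.
rewrite -/(mol u k x') -/(mol u k x) => E.
rewrite -opprB E opprK (bigD1 i)//= [X in _ + X]big1 ?addr0 => [|j ji].
  apply: eq_Rintegral => y _; congr (_ * prodf _ y); apply/funext => j.
  rewrite /prodf_mix /bar /updf; have [->|ji] := eqVneq j i; first by rewrite ltnn x'i.
  by case: ifP => // _; rewrite x'j.
rewrite (@eq_Rintegral _ _ _ _ _ (cst 0)) ?Rintegral_cst ?mul0r// => y _.
rewrite -(updf_id (prodf_mix _ _ _ j) j) prodf_upd /prodf_mix ltnn eqxx x'j//.
by rewrite /dker subrr mul0r mulr0.
Qed.

(** [bar] has mass t and sees only points whose coordinates are within t + 2^-k of those of x; there
    the Hoelder function [g], which represents [G i], is close to g x. *)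
Lemma mol_increment_le k t x : 0 <= t ->
  `|mol u k (t *: delta_mx ord0 i + x) - mol u k x - t * g x| <=
  K * (t + 2 ^- k) `^ gamma * t.
Proof.
move=> t0; rewrite mol_increment//.
have [ib Ib] := integral_bar k x t0.
have [C hC] := bar_bounded k t x.
have lG := Lfun_locally_integrable (ltW p1) (Gp i).
have [iG _] := Rintegral_prodf_bound lG (measurable_bar k t x) (bar_support (k := k) (x := x) t0) hC.
have icb : mu.-integrable setT (EFin \o (fun y => g x * prodf (bar k t x) y)).
  exact: (integrableZl measurableT (g x) ib).
have iE : mu.-integrable setT (EFin \o (fun y => G i y * prodf (bar k t x) y -
    g x * prodf (bar k t x) y)) by exact: (integrableB measurableT iG icb).
have -> : t * g x = \int[mu]_y (g x * prodf (bar k t x) y).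
  by rewrite RintegralZl// Ib mulrC.
rewrite -RintegralB//.
apply: (le_trans (le_normr_Rintegral measurableT iE)).
set r := _ `^ gamma.
have -> : K * r * t = \int[mu]_y (K * r * prodf (bar k t x) y).
  by rewrite RintegralZl// Ib.
have irb : mu.-integrable setT (EFin \o (fun y => K * r * prodf (bar k t x) y)).
  exact: (integrableZl measurableT (K * r) ib).
have iN := integrable_norm iE.
apply: fine_le; [exact: (integrable_fin_num measurableT iN)|
  exact: (integrable_fin_num measurableT irb)|].
have Kr0 : 0 <= K * r by rewrite mulr_ge0// powR_ge0.
apply: ae_ge0_le_integral.
- exact: measurableT.
- by move=> y _; rewrite lee_fin.
- exact: measurable_int iN.
- by move=> y _; rewrite lee_fin; exact: mulr_ge0 Kr0 (bar_ge0 _ _ _ t0).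
- exact: measurable_int irb.
apply: filterS Gg => y Gy _; rewrite lee_fin Gy -mulrBl normrM.
rewrite (ger0_norm (bar_ge0 k x y t0)).
have [b0|bN0] := eqVneq (prodf (bar k t x) y) 0; first by rewrite b0 !mulr0.
rewrite ler_wpM2r ?bar_ge0//; apply: gK => j.
apply: (bar_support t0).
by apply: contra_neq bN0 => bj; rewrite -(updf_id (bar k t x) j) prodf_upd bj mul0r.
Qed.

Lemma limit_increment_le t x : 0 < t ->
  `|v (t *: delta_mx ord0 i + x) - v x - t * g x| <= K * (2 * t) `^ gamma * t.
Proof.
move=> t0; set x' := _ + x.
have cvd : `|mol u k x' - mol u k x - t * g x| @[k --> \oo] --> `|v x' - v x - t * g x|.
  apply: cvg_norm; apply: cvgB; last exact: cvg_cst.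
  by apply: cvgB; exact: mv.
rewrite -(cvg_lim (@Rhausdorff R) cvd); apply: limr_le; first by apply/cvg_ex; eexists; exact: cvd.
have : (geometric 1 (2^-1 : R)) @ \oo --> (0 : R).
  by apply: cvg_geometric; rewrite ger0_norm ?invr_ge0// invf_lt1// ltr1n.
move/cvgr0Pnorm_le => /(_ t t0); apply: filterS => k /=.
rewrite mul1r exprVn ger0_norm ?invr_ge0 ?exprn_ge0// => kt.
apply: (le_trans (mol_increment_le k x (ltW t0))).
rewrite ler_wpM2r ?(ltW t0)// ler_wpM2l//.
apply: ge0_ler_powR; rewrite ?nnegrE ?(ltW g0)//.
- by rewrite addr_ge0 ?(ltW t0)// invr_ge0 exprn_ge0.
- by rewrite mulr_ge0// ltW.
- by rewrite mulrDl !mul1r lerD2l.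
Qed.

Lemma is_derive_limit x : is_derive x (delta_mx ord0 i : 'rV[R]_n) v (g x).
Proof.
pose L := K * 2 `^ gamma + K.
have L0 : 0 <= L by rewrite addr_ge0// mulr_ge0// powR_ge0.
have est (h : R) : h != 0 -> `|v (h *: delta_mx ord0 i + x) - v x - h * g x| <= L * `|h| `^ gamma * `|h|.
  move=> hN0; have [hp|hn] := ltP 0 h.
    apply: (le_trans (limit_increment_le x hp)); rewrite gtr0_norm//.
    rewrite ler_wpM2r ?(ltW hp)// powRM ?(ltW hp)// mulrA ler_wpM2r ?powR_ge0//.
    by rewrite /L lerDl.
  have hp : 0 < - h by rewrite oppr_gt0 lt_neqAle hN0.
  set y := h *: delta_mx ord0 i + x.
  have xy : x = (- h) *: delta_mx ord0 i + y by rewrite /y addrA -scalerDl addNr scale0r add0r.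
  have := limit_increment_le y hp; rewrite -xy => H1.
  have H2 : `|g x - g y| <= K * `|h| `^ gamma.
    apply: gK => j; rewrite /y !mxE eqxx/= opprD addrCA subrr addr0 normrN normrM.
    by case: eqP => _; rewrite ?normr1 ?mulr1// normr0 mulr0.
  rewrite (_ : v y - v x - h * g x = - (v x - v y - (- h) * g y) + (- h) * (g x - g y)); last by ring.
  apply: (le_trans (ler_normD _ _)); rewrite normrN normrM (gtr0_norm hp).
  rewrite (ler0_norm hn) mulrDl mulrDl lerD//.
    apply: (le_trans H1); rewrite ler_wpM2r ?(ltW hp)//.
    by rewrite powRM ?(ltW hp)// mulrA.
  by rewrite mulrC ler_wpM2r ?(ltW hp)//; move: H2; rewrite (ler0_norm hn).
have C : h^-1 *: (v (h *: (delta_mx ord0 i : 'rV[R]_n) + x) - v x) @[h --> (0 : R)^'] --> g x.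
  apply/cvgrPdist_lt => e e0.
  near=> h.
  have hN0 : h != 0 by near: h; exact: nbhs_dnbhs_neq.
  have hp : 0 < `|h| by rewrite normr_gt0.
  rewrite distrC.
  have -> : h^-1 *: (v (h *: delta_mx ord0 i + x) - v x) - g x =
      h^-1 * (v (h *: delta_mx ord0 i + x) - v x - h * g x).
    by rewrite [RHS]mulrBr mulrA mulVf// mul1r.
  rewrite normrM normfV mulrC ltr_pdivrMr//.
  apply: (le_lt_trans (est h hN0)); rewrite ltr_pM2r//.
  have hd : `|h| < (e / (L + 1)) `^ gamma^-1.
    by near: h; apply: dnbhs0_lt; rewrite powR_gt0// divr_gt0// ltr_wpDl.
  have : `|h| `^ gamma < e / (L + 1).
    have eL : 0 <= e / (L + 1) by rewrite divr_ge0 ?(ltW e0)// addr_ge0.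
    have := gt0_ltr_powR g0 _ _ hd; rewrite !nnegrE normr_ge0 powR_ge0 => /(_ isT isT).
    by rewrite -powRrM mulVf ?gt_eqF// powRr1.
  rewrite ltr_pdivlMr; last by rewrite ltr_wpDl.
  move=> h2; have := powR_ge0 `|h| gamma; nra.
have ex : derivable v x (delta_mx ord0 i) by apply/cvg_ex; eexists; exact: C.
by apply: DeriveDef => //; apply/cvg_lim.
Unshelve. all: by end_near. Qed.

End derivative.

Lemma continuous_coord_holder (C : R) (w : 'rV[R]_n -> R) : coord_holder C w -> continuous w.
Proof.
move=> wC x; have C0 : 0 <= C.
  have := wC x x 1; rewrite powR1 mulr1 => h.
  by apply: le_trans (h _) => // i; rewrite subrr normr0.
apply: (cvgrPdist_lt _ _ (FF := nbhs_filter x)).2 => e e0.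
pose d := (e / (C + 1)) `^ gamma^-1.
have eC : 0 < e / (C + 1) by rewrite divr_gt0// ltr_wpDl.
have d0 : 0 < d by exact: powR_gt0.
have : \forall y \near x, ball x d y by exact: nbhsx_ballx.
apply: filterS => y xy; rewrite distrC.
have xyd j : `|y ord0 j - x ord0 j| <= d.
  by rewrite distrC; exact: ltW (xy.2 ord0 j).
apply: (le_lt_trans (wC _ _ _ xyd)).
rewrite /d -powRrM mulVf ?gt_eqF// powRr1 ?(ltW eC)//.
by rewrite mulrA ltr_pdivrMr ?ltr_wpDl// mulrDr mulr1 mulrC ltrDl.
Qed.

(** By [is_derive_limit] the partial derivatives of the representative of [u] are the
    representatives of the [G i], whose own weak gradients [H i] make them bounded and Hoelder. *)
Lemma Cb1_holder_of_W2p (u : 'rV[R]_n -> R) (G : 'I_n -> 'rV[R]_n -> R)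
    (H : 'I_n -> 'I_n -> 'rV[R]_n -> R) :
  u \in Lfun mu p%:E -> (forall i, G i \in Lfun mu p%:E) ->
  (forall i j, H i j \in Lfun mu p%:E) ->
  (forall i, weak_partial_real i u (G i)) ->
  (forall i j, weak_partial_real j (G i) (H i j)) ->
  exists2 v, Cb1_holder_real gamma v & {ae mu, forall x, u x = v x}.
Proof.
move=> up Gp Hp wG wH.
have [v [C C0 [mv vC vH uv]]] := morrey_limit up Gp wG.
have [g hg] : {g : 'I_n -> 'rV[R]_n -> R & forall i, exists2 D, 0 <= D &
  [/\ forall x, `|g i x| <= D, coord_holder D (g i) & {ae mu, forall x, G i x = g i x}]}.
  apply: (@choice _ _ (fun i gi => exists2 D, 0 <= D &
    [/\ forall x, `|gi x| <= D, coord_holder D gi & {ae mu, forall x, G i x = gi x}])) => i.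
  have [w [D D0 [_ wD wH' Gw]]] := morrey_limit (Gp i) (Hp i) (wH i).
  by exists w, D.
have dv i x : is_derive x (delta_mx ord0 i : 'rV[R]_n) v (g i x).
  have [D D0 [_ gH Gg]] := hg i.
  exact: (is_derive_limit up Gp wG D0 mv gH Gg).
have pv i : partial i v = g i.
  by apply/funext => x; rewrite /partial; have [] := dv i x.
exists v => //; split.
- split; first exact: continuous_coord_holder vH.
  move=> i; split; first by move=> x; have [] := dv i x.
  by rewrite /= pv; have [D D0 [_ gH _]] := hg i; exact: continuous_coord_holder gH.
- by exists C.
- by move=> i; rewrite pv; have [D D0 [gD _ _]] := hg i; exists D.
- move=> i; rewrite pv; have [D D0 [_ gH _]] := hg i; exists D => x y.
  apply: gH => j; rewrite /enorm -sqrtr_sqr; apply: ler_wsqrtr.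
  by rewrite (bigD1 j)//= !mxE lerDl sumr_ge0// => k _; exact: sqr_ge0.
Qed.

End morrey.

(** * Complex-valued functions, through real and imaginary parts *)

Section complex_Lp.
Context {R : realType} (n : nat).
Local Open Scope complex_scope.
Local Notation mu := (@lebesgue_rV R n).
Local Notation normc := ComplexField.Normc.normc.
Implicit Types (u v w : 'rV[R]_n -> R[i]) (p : R) (c : R[i]).

Definition measurable_complex u : Prop :=
  measurable_fun setT (@complex.Re R \o u) /\ measurable_fun setT (@complex.Im R \o u).

Lemma Lp_measurable (r : \bar R) u : Lp r u -> measurable_complex u.
Proof. by move=> [ur ui]; split; [exact: Lfun_measurable ur|exact: Lfun_measurable ui]. Qed.

Lemma measurable_complexB u v : measurable_complex u -> measurable_complex v ->
  measurable_complex (fun x => u x - v x).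
Proof.
move=> [ur ui] [vr vi]; split.
- rewrite (_ : _ \o _ = (@complex.Re R \o u) \- (@complex.Re R \o v)); first exact: measurable_funB.
  by apply/funext => x /=; case: (u x) (v x) => [a b] [a' b'].
- rewrite (_ : _ \o _ = (@complex.Im R \o u) \- (@complex.Im R \o v)); first exact: measurable_funB.
  by apply/funext => x /=; case: (u x) (v x) => [a b] [a' b'].
Qed.

Lemma measurable_complexZ c u : measurable_complex u -> measurable_complex (fun x => c * u x).
Proof.
case: c => a b [ur ui]; split.
- rewrite (_ : _ \o _ = (cst a \* (@complex.Re R \o u)) \- (cst b \* (@complex.Im R \o u))).
    by apply: measurable_funB; apply: measurable_funM => //; exact: measurable_cst.
  by apply/funext => x /=; case: (u x).
- rewrite (_ : _ \o _ = (cst a \* (@complex.Im R \o u)) \+ (cst b \* (@complex.Re R \o u))).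
    by apply: measurable_funD; apply: measurable_funM => //; exact: measurable_cst.
  by apply/funext => x /=; case: (u x).
Qed.

Lemma measurable_normc u : measurable_complex u -> measurable_fun setT (fun x => normc (u x)).
Proof.
move=> [ur ui].
rewrite (_ : (fun x => _) = (@powR R ^~ 2^-1) \o
    (fun x => complex.Re (u x) ^+ 2 + complex.Im (u x) ^+ 2)); last first.
  by apply/funext => x /=; rewrite powR12_sqrt ?addr_ge0 ?sqr_ge0//; case: (u x).
apply: (measurableT_comp (measurable_powR _)).
by apply: measurable_funD; apply: (measurableT_comp (exprn_measurable 2)).
Qed.

Lemma normc_ge0 c : 0 <= normc c. Proof. by case: c => a b; exact: sqrtr_ge0. Qed.

Lemma normc_real (a : R) : 0 <= a -> normc a%:C = a.
Proof. by move=> a0; rewrite /= expr0n/= addr0 sqrtr_sqr ger0_norm. Qed.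

Lemma Lp_norm_ae_le p (k : R) u v : 0 < p -> 0 <= k ->
  measurable_complex u -> measurable_complex v ->
  {ae mu, forall x, normc (u x) <= k * normc (v x)} ->
  (Lp_norm p%:E u <= k%:E * Lp_norm p%:E v)%E.
Proof.
move=> p0 k0 mu_ mv uv.
have mp w : measurable_complex w ->
    measurable_fun setT (fun x => (`|normc (w x)| `^ p)%:E).
  move=> mw; apply/measurable_EFinP; apply: (measurableT_comp (measurable_powR _)).
  exact: measurableT_comp (measurable_normc mw).
rewrite /Lp_norm unlock.
have -> : k%:E = ((k `^ p)%:E `^ p^-1)%E.
  by rewrite poweR_EFin -powRrM mulfV ?gt_eqF// powRr1.
have i0 w : (0 <= \int[mu]_x `|(normc (w x))%:E| `^ p)%E.
  by apply: integral_ge0 => x _; exact: poweR_ge0.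
rewrite -poweRM ?lee_fin ?powR_ge0//.
apply: gt0_ler_poweR.
- by rewrite invr_ge0 ltW.
- by rewrite in_itv/= leey andbT i0.
- by rewrite in_itv/= leey andbT mule_ge0 ?i0// lee_fin powR_ge0.
rewrite -ge0_integralZl_EFin//; last 3 first.
- by move=> x _; exact: poweR_ge0.
- exact: mp.
- exact: powR_ge0.
apply: ae_ge0_le_integral => //.
- by move=> x _; exact: poweR_ge0.
- exact: mp.
- by move=> x _; apply: mule_ge0; rewrite ?poweR_ge0// lee_fin powR_ge0.
- by apply: emeasurable_funM; [exact: measurable_cst|exact: mp].
apply: filterS uv => x uvx _.
rewrite /= -EFinM lee_fin -powRM// !(ger0_norm (normc_ge0 _)).
apply: ge0_ler_powR; rewrite ?nnegrE ?(ltW p0) ?normc_ge0//.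
by rewrite mulr_ge0// normc_ge0.
Qed.

(** The modulus is at most |Re u| + |Im u|, which lies in the real L^p space. *)
Lemma Lp_norm_lty p u : 1 <= p -> Lp p%:E u -> (Lp_norm p%:E u < +oo)%E.
Proof.
move=> p1 up; have [ur ui] := up.
have : (fun x => normc (u x)) \in Lfun mu p%:E.
  have gp : (fun x => `|complex.Re (u x)|) \+ (fun x => `|complex.Im (u x)|) \in Lfun mu p%:E.
    apply: rpredD.
      by apply: (Lfun_ae_le p1 _ ur); [exact: measurableT_comp (Lfun_measurable ur)|
        apply: aeW => x; rewrite normr_id].
    by apply: (Lfun_ae_le p1 _ ui); [exact: measurableT_comp (Lfun_measurable ui)|
        apply: aeW => x; rewrite normr_id].
  apply: (Lfun_ae_le p1 (measurable_normc (Lp_measurable up)) gp).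
  apply: aeW => x /=; rewrite ger0_norm ?normc_ge0//.
  rewrite [leRHS]ger0_norm ?addr_ge0//; case: (u x) => a b /=.
  rewrite -[leRHS]ger0_norm ?addr_ge0// -sqrtr_sqr; apply: ler_wsqrtr.
  rewrite -(real_normK (num_real a)) -(real_normK (num_real b)) sqrrD.
  by rewrite lerD2r lerDl mulrn_wge0// mulr_ge0.
by rewrite inE => /andP[_]; rewrite inE.
Qed.

Lemma Lp_ae_eq p u v : 1 <= p -> measurable_complex u -> Lp p%:E v ->
  u = v %[ae mu] -> Lp p%:E u.
Proof.
move=> p1 [mur mui] [vr vi] uv; split.
- by apply: (Lfun_ae_le p1 mur vr); apply: filterS uv => x /= -> //.
- by apply: (Lfun_ae_le p1 mui vi); apply: filterS uv => x /= -> //.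
Qed.

Lemma W2p_sobolev_gain p u (G : 'I_n -> 'rV[R]_n -> R[i])
    (H : 'I_n -> 'I_n -> 'rV[R]_n -> R[i]) : 1 < p -> (0 < n)%N ->
  W2p p%:E u G H -> Lp (p * sobolev_ratio n)%:E u.
Proof.
move=> p1 n0 [[ur ui] uG _]; split.
- by apply: (sobolev_gain p1 n0 ur (G := fun i => @complex.Re R \o G i)) => i;
    have [[Gr Gi] [wr wi]] := uG i.
- by apply: (sobolev_gain p1 n0 ui (G := fun i => @complex.Im R \o G i)) => i;
    have [[Gr Gi] [wr wi]] := uG i.
Qed.

Lemma W2p_Cb1_holder p (gamma : R) u (G : 'I_n -> 'rV[R]_n -> R[i])
    (H : 'I_n -> 'I_n -> 'rV[R]_n -> R[i]) : 1 < p -> (0 < n)%N -> 0 < gamma ->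
  n%:R / p <= 1 - gamma -> W2p p%:E u G H ->
  exists2 g, Cb1_holder gamma g & u = g %[ae mu].
Proof.
move=> p1 n0 g0 pg [[ur ui] uG uH].
have [rho [P [S [M [srho dP dS [lo hi M0 bnd rho0]]]]]] := @mollifier_exists R.
have rhoP : is_mollifier rho P M.
  split => // s; first by move=> /lo[].
  by move=> /hi[].
have S0 s : s <= 0 -> S s = 0 by move=> /lo[].
have S1 s : 1 <= s -> S s = S 1 + (s - 1) by move=> /hi[].
have [vr Cr er] : exists2 v, Cb1_holder_real gamma v & {ae mu, forall x, complex.Re (u x) = v x}.
  apply: (Cb1_holder_of_W2p rhoP p1 n0 g0 pg dS S0 S1 ur (G := fun i => @complex.Re R \o G i)
      (H := fun i j => @complex.Re R \o H i j)) => [i|i j|i|i j].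
  - by have [[]] := uG i.
  - by have [[]] := uH i j.
  - by have [_ []] := uG i.
  - by have [_ []] := uH i j.
have [vi Ci ei] : exists2 v, Cb1_holder_real gamma v & {ae mu, forall x, complex.Im (u x) = v x}.
  apply: (Cb1_holder_of_W2p rhoP p1 n0 g0 pg dS S0 S1 ui (G := fun i => @complex.Im R \o G i)
      (H := fun i j => @complex.Im R \o H i j)) => [i|i j|i|i j].
  - by have [[]] := uG i.
  - by have [[]] := uH i j.
  - by have [_ []] := uG i.
  - by have [_ []] := uH i j.
exists (fun x => vr x +i* vi x) => //.
apply: filterS2 er ei => x er ei _; rewrite -er -ei.
by case: (u x).
Qed.

Lemma Cb1_holder_Lpy (gamma : R) u g : measurable_complex u ->
  Cb1_holder gamma g -> u = g %[ae mu] -> Lp +oo%E u.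
Proof.
move=> [mr mi] [[_ [A gA] _ _] [_ [B gB] _ _]] ug.
have bdd (f : 'rV[R]_n -> R) C : measurable_fun setT f -> {ae mu, forall x, `|f x| <= C} ->
    f \in Lfun mu +oo%E.
  move=> mf fC; rewrite inE; apply/andP; split; rewrite inE//=.
  rewrite /finite_norm unlock; case: ifPn => // _.
  apply: (@le_lt_trans _ _ C%:E); last exact: ltry.
  by apply/ess_supP; apply: filterS fC => x /=; rewrite lee_fin.
split.
- by apply: (bdd _ A mr); apply: filterS ug => x /= ->//; exact: gA.
- by apply: (bdd _ B mi); apply: filterS ug => x /= ->//; exact: gB.
Qed.

End complex_Lp.

(** * Smoothing into the domain of the generator *)

Section semigroup_regularity.
Context {R : realType} (n : nat).
Local Open Scope complex_scope.
Local Notation mu := (@lebesgue_rV R n).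
Local Notation normc := ComplexField.Normc.normc.
Variables (alpha beta p : R) (T : R -> ('rV[R]_n -> R[i]) -> 'rV[R]_n -> R[i]).
Hypothesis p1 : 1 < p.
Hypothesis TC0 : C0_semigroup p%:E T.
Hypothesis Tgen : generates p%:E (A_graph alpha beta p%:E) T.
Hypothesis Tana : analytic_semigroup p%:E T.

Lemma semigroup_Lp t f : 0 <= t -> Lp p%:E f -> Lp p%:E (T t f).
Proof. by move=> t0 fp; have [/(_ t t0)[h _ _] _ _ _] := TC0; exact: h. Qed.

(* The complex derivative of the analytic extension at [t] is [A T(t)]. *)
Lemma semigroup_W2p t f : 0 < t -> Lp p%:E f ->
  exists G H, W2p p%:E (T t f) G H.
Proof.
move=> t0 fp.
suff [g gp [G [H [[]]]]] : exists2 g, Lp p%:E g & A_graph alpha beta p%:E (T t f) g.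
  by exists G, H.
have [theta [Z [/andP[th0 _] ZT [Zb _ hol _]]]] := Tana.
have sec (s : R) : 0 < s -> sector theta s%:C.
  by move=> s0; exists s, 0; rewrite normr0 cos0 sin0 mulr0 mulr1.
have [D [DL _ _] HD] := hol _ (sec t t0).
have Tp := semigroup_Lp (ltW t0) fp.
exists (D f); first exact: DL.
apply/(Tgen Tp (DL _ fp)).
have [_ _ Tadd _] := TC0.
have p0 : 0 < p := lt_trans ltr01 p1.
set L := Lp_norm p%:E f.
have L0 : (0 <= L)%E by exact: Lnorm_ge0.
have Loo : (L < +oo)%E by exact: Lp_norm_lty (ltW p1) fp.
have Lf : L \is a fin_num by rewrite ge0_fin_numE.
set X := fun h : R => Lp_norm _ _.
have X0 h : (0 <= X h)%E by exact: Lnorm_ge0.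
(* Restricted to real increments h and divided by h, the operator-norm estimate for [Z] at t bounds
   the generator's difference quotient at T(t) f, since T(h) T(t) f = T(t + h) f. *)
have est (e : R) : 0 < e -> \forall h \near 0^'+, (X h <= e%:E * L)%E.
  move=> e0; have [d d0 Hd] := HD e e0.
  near=> h.
  have h0 : 0 < h by near: h; exact: nbhs_right_gt.
  have hd : h < d by near: h; exact: nbhs_right_lt.
  have th : 0 < t + h by exact: addr_gt0.
  have nh : normc h%:C = h by exact: normc_real (ltW h0).
  have Cth : t%:C + h%:C = (t + h)%:C :> R[i] by rewrite -rmorphD.
  have := Hd h%:C; rewrite nh Cth => /(_ hd (sec _ th) f fp) Y.
  have mZ (s : R) : 0 < s -> measurable_complex (Z s%:C f).
    by move=> s0; have [/(_ f fp)/Lp_measurable] := Zb _ (sec s s0).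
  apply: (@le_trans _ _ ((h^-1)%:E * ((e * h)%:E * L))%E); last first.
    by rewrite muleA -EFinM mulrCA mulVf ?gt_eqF// mulr1.
  apply: le_trans (lee_wpmul2l _ Y); last by rewrite lee_fin invr_ge0 ltW.
  apply: Lp_norm_ae_le => //.
  - by rewrite invr_ge0 ltW.
  - apply: measurable_complexB; last exact: Lp_measurable (DL _ fp).
    apply: measurable_complexZ; apply: measurable_complexB; last exact: Lp_measurable Tp.
    exact: Lp_measurable (semigroup_Lp (ltW h0) Tp).
  - apply: measurable_complexB; last exact: measurable_complexZ (Lp_measurable (DL _ fp)).
    by apply: measurable_complexB; exact: mZ.
  have E1 := Tadd h t f (ltW h0) (ltW t0) fp.
  have E2 := ZT _ f t0 fp; have E3 := ZT _ f th fp.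
  apply: filterS3 E1 E2 E3 => x /(_ I) e1 /(_ I) e2 /(_ I) e3.
  rewrite -e1 [h + t]addrC -e2 -e3.
  have -> : (h^-1)%:C * (Z (t + h)%:C f x - Z t%:C f x) - D f x =
      (h^-1)%:C * (Z (t + h)%:C f x - Z t%:C f x - h%:C * D f x).
    by rewrite [RHS]mulrBr mulrA -rmorphM mulVf ?gt_eqF// rmorph1 mul1r.
  by rewrite ComplexField.Normc.normcM normc_real// invr_ge0 ltW.
apply/fine_cvgP; split.
  apply: filterS (est 1 ltr01) => h hL; rewrite ge0_fin_numE//.
  by apply: le_lt_trans hL _; rewrite mul1e.
apply/cvgr0Pnorm_le => e e0.
have fL0 : 0 <= fine L by exact: fine_ge0.
(* The added 1 covers the case where the norm of [f] is 0. *)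
have eL : 0 < e / (fine L + 1) by rewrite divr_gt0// ltr_wpDl.
apply: filterS (est _ eL) => h hL /=.
rewrite ger0_norm ?fine_ge0//.
have Xf : X h \is a fin_num.
  rewrite ge0_fin_numE//; apply: le_lt_trans hL _.
  by rewrite -(fineK Lf) -EFinM ltry.
move: hL; rewrite -(fineK Lf) -(fineK Xf) -EFinM lee_fin => /le_trans; apply.
by rewrite mulrAC ler_pdivrMr ?ltr_wpDl// mulrDr mulr1 lerDl ltW.
Unshelve. all: by end_near. Qed.

End semigroup_regularity.

Local Open Scope complex_scope.

(** * Bootstrap over the exponents *)

Section ultracontractivity.
Context {R : realType} (N : nat).
Local Notation mu := (lebesgue_rV N).
Variables (alpha beta : R) (T : R -> R -> ('rV[R]_N -> R[i]) -> 'rV[R]_N -> R[i]).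
Hypothesis N0 : (0 < N)%N.
Hypothesis hC0 : forall p : R, 1 < p -> C0_semigroup p%:E (T p).
Hypothesis hgen : forall p : R, 1 < p ->
  generates p%:E (A_graph alpha beta p%:E) (T p).
Hypothesis hanalytic : forall p : R, 1 < p -> analytic_semigroup p%:E (T p).
Hypothesis hcons : forall (p q t : R) (f : 'rV[R]_N -> R[i]),
  1 < p -> 1 < q -> 0 <= t -> Lp p%:E f -> Lp q%:E f ->
  T p t f = T q t f %[ae lebesgue_rV N].

Let ratio : R := sobolev_ratio N.

Let ratio_gt1 : 1 < ratio.
Proof. by rewrite /ratio /sobolev_ratio ltrDl invr_gt0 ltr0n. Qed.

Let exponent_gt1 p m : 1 < p -> 1 < p * ratio ^+ m.
Proof.
move=> p1; apply: (lt_le_trans p1); apply: ler_peMr; first exact: ltW (lt_trans ltr01 p1).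
by apply: exprn_ege1; exact: ltW ratio_gt1.
Qed.

Let half_gt0 (t : R) : 0 < t -> 0 < t / 2. Proof. by move=> t0; rewrite divr_gt0. Qed.

(* Writing T(t) = T(t/2) T(t/2), the outer factor may be taken in the better space. *)
Let semigroup_consistent p q t f : 1 < p -> 1 < q -> 0 < t -> Lp p%:E f ->
  Lp q%:E (T p (t / 2) f) ->
  T p t f = T q (t / 2) (T p (t / 2) f) %[ae mu].
Proof.
move=> p1 q1 t0 fp hq; have t2 := half_gt0 t0.
have hp := semigroup_Lp (hC0 p1) (ltW t2) fp.
have [_ _ Tadd _] := hC0 p1.
have := Tadd _ _ f (ltW t2) (ltW t2) fp; rewrite -splitr.
have := hcons p1 q1 (ltW t2) hp hq.
by apply: filterS2 => x e1 e2 _; rewrite e2// e1.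
Qed.

(** Each gain spends half of the remaining time, so the induction hypothesis must hold for every
    t. *)
Lemma semigroup_Lp_gain p m t f : 1 < p -> 0 < t -> Lp p%:E f ->
  Lp (p * ratio ^+ m)%:E (T p t f).
Proof.
move=> p1; elim: m t => [|m IH] t t0 fp.
  by rewrite expr0 mulr1; exact: (semigroup_Lp (hC0 p1) (ltW t0) fp).
have t2 := half_gt0 t0; have q1 := exponent_gt1 m p1.
have hq := IH _ t2 fp.
have [G [H W]] := semigroup_W2p q1 (hC0 q1) (hgen q1) (hanalytic q1) t2 hq.
have := W2p_sobolev_gain q1 N0 W; rewrite -/ratio -mulrA -exprSr => hL.
apply: Lp_ae_eq hL _.
- exact: (ltW (exponent_gt1 m.+1 p1)).
- exact: (Lp_measurable (semigroup_Lp (hC0 p1) (ltW t0) fp)).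
- exact: (semigroup_consistent p1 q1 t0 fp hq).
Qed.

(** The first half of the time raises the exponent to a q with N/q <= 1 - gamma; during the second
    half the semigroup acts in L^q, where Morrey's inequality applies to its domain. *)
Lemma semigroup_Cb1_holder p f gamma t : 1 < p -> Lp p%:E f -> 0 < gamma < 1 -> 0 < t ->
  exists2 g, Cb1_holder gamma g & T p t f = g %[ae mu].
Proof.
move=> p1 fp /andP[g0 g1] t0; have t2 := half_gt0 t0.
have [m hm] : exists m, N%:R / (p * ratio ^+ m) <= 1 - gamma.
  (* Bernoulli's inequality: as soon as k exceeds N^2 / (1 - gamma), the k-th power of the ratio is
     at least N / (1 - gamma). *)
  have ge1 k : 1 + k%:R * N%:R^-1 <= ratio ^+ k.
    elim: k => [|k IH]; first by rewrite mul0r addr0.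
    rewrite exprS; apply: le_trans (ler_wpM2l (ltW (lt_trans ltr01 ratio_gt1)) IH).
    rewrite /ratio /sobolev_ratio -(natr1 k).
    have : 0 <= k%:R * N%:R^-1 * N%:R^-1 :> R by rewrite !mulr_ge0// invr_ge0.
    by nra.
  have N0' : 0 < N%:R :> R by rewrite ltr0n.
  have b0 : 0 <= N%:R * N%:R / (1 - gamma) :> R.
    by rewrite divr_ge0 ?mulr_ge0// subr_ge0 ltW.
  exists (Num.truncn (N%:R * N%:R / (1 - gamma))).+1.
  set m := _.+1; have hm : N%:R * N%:R / (1 - gamma) < m%:R by exact: truncnS_gt.
  rewrite ler_pdivrMr; last exact: lt_trans ltr01 (exponent_gt1 m p1).
  have : N%:R / (1 - gamma) <= ratio ^+ m.
    apply: le_trans (ge1 m); rewrite -lerBlDl.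
    apply: (@le_trans _ _ (N%:R / (1 - gamma))); first by rewrite lerBlDr lerDl.
    by rewrite ler_pdivlMr// mulrAC ltW.
  rewrite ler_pdivrMr ?subr_gt0// => /le_trans; apply.
  rewrite mulrC ler_wpM2l ?subr_ge0 ?(ltW g1)// ler_peMl ?(ltW p1)//.
  by rewrite exprn_ge0// ltW// (lt_trans ltr01).
have q1 := exponent_gt1 m p1; have hq := semigroup_Lp_gain m p1 t2 fp.
have [G [H W]] := semigroup_W2p q1 (hC0 q1) (hgen q1) (hanalytic q1) t2 hq.
have [g Cg eg] := W2p_Cb1_holder q1 N0 g0 hm W.
exists g => //.
have := semigroup_consistent p1 q1 t0 fp hq; move: eg.
by apply: filterS2 => x e1 e2 _; rewrite e2// e1.
Qed.

End ultracontractivity.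

Theorem proposition2p6 (R : realType) (N : nat) (hN : (0 < N)%N)
    (alpha beta : R) (halpha : 0 <= alpha <= 2) (hbeta : 0 <= beta)
    (hab : alpha ^+ 2 + beta ^+ 2 != 0)
    (T : R -> R -> ('rV[R]_N -> R[i]) -> 'rV[R]_N -> R[i])
    (hC0 : forall p : R, 1 < p -> C0_semigroup p%:E (T p))
    (hgen : forall p : R, 1 < p ->
       generates p%:E (A_graph alpha beta p%:E) (T p))
    (hanalytic : forall p : R, 1 < p -> analytic_semigroup p%:E (T p))
    (hpos : forall p t : R, 1 < p -> 0 <= t ->
       positive_operator p%:E (T p t))
    (hcons : forall (p q t : R) (f : 'rV[R]_N -> R[i]),
       1 < p -> 1 < q -> 0 <= t -> Lp p%:E f -> Lp q%:E f ->
       T p t f = T q t f %[ae lebesgue_rV N]) :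
  (forall (p : R) (f : 'rV[R]_N -> R[i]) (gamma t : R),
     1 < p -> Lp p%:E f -> 0 < gamma < 1 -> 0 < t ->
     exists2 g : 'rV[R]_N -> R[i],
       Cb1_holder gamma g & T p t f = g %[ae lebesgue_rV N]) /\
  (forall (p t : R) (f : 'rV[R]_N -> R[i]),
     1 < p -> 0 < t -> Lp p%:E f -> Lp +oo%E (T p t f)).
Proof.
have reg := semigroup_Cb1_holder hN hC0 hgen hanalytic hcons.
split=> [|p t f p1 t0 fp]; first exact: reg.
(* Boundedness can be read off from any one Hoelder exponent; 1/2 is taken. *)
have h1 : 0 < (2^-1 : R) < 1 by rewrite invr_gt0 ltr0n invf_lt1 ?ltr1n.
have [g Cg eg] := reg p f 2^-1 t p1 fp h1 t0.
exact: (Cb1_holder_Lpy (Lp_measurable (semigroup_Lp (hC0 p p1) (ltW t0) fp)) Cg eg).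
Qed.
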